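(* Let $n\ge2$, $A_1,\dots,A_d\in\mathfrak{su}(n)$, and $\mathrm S_1\subseteq\{B_{ij}\}$, $\mathrm S_2\subseteq\{C_{ij}\}$, $\mathrm S_3\subseteq\{D_{ij}\}$ (all with $1\le i<j\le n$). Let $\mathscr G_{\rm drift}$ and $\mathscr G_{\rm contr}$ be the edge-colored multigraphs defined in the context, and suppose $\mathscr G_{\rm contr}$ is not connected. Then the system $\dot X=\mathsf B_0X+(\sum_{i=1}^m u_i\mathsf B_i)X$ is structurally controllable on $\mathrm{SU}(n)$ with respect to the pair of zero patterns $\big(\Sigma_{\rm r}(\{A_1,\dots,A_d\}),\Sigma_{\rm f}(\mathrm S_1\cup\mathrm S_2\cup\mathrm S_3)\big)$ if the following hold: (i) each connected component of $\mathscr G_{\rm contr}$ contains at least three nodes; (ii) $\mathscr G_{\rm drift}$ has no multi-edges and the union $\mathscr G_{\rm drift}\cup\mathscr G_{\rm contr}$ is connected; (iii) $\mathscr G_{\rm drift}\cup\mathscr G_{\rm contr}$ has a self-loop or a cycle containing an odd number of Red edges.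
   Context: $E_{ij}$ is the $n\times n$ matrix unit; $B_{ij}=E_{ij}-E_{ji}$, $C_{ij}=\mathrm i(E_{ij}+E_{ji})$, $D_{ij}=\mathrm i(E_{ii}-E_{jj})$. $\mathfrak{su}(n)$ (traceless skew-Hermitian matrices, a real Lie algebra) is the Lie algebra of $\mathrm{SU}(n)$. For a finite subset $\{g_s\}$ of a real Lie algebra, $\Sigma_{\rm f}(\{g_s\})=\{\sum l_sg_s:l_s\in\mathbb R\}$, $\Sigma_{\rm r}(\{g_s\})=\{\sum l_sg_s:l_s\in\mathbb R,l_s\ne0\ \forall s\}$. An edge-colored multigraph on $\mathrm V=\{1,\dots,n\}$ has edges $\{i,j;c\}$, $c\in\{\text{Blue},\text{Red},\text{Green}\}$; $\{i,i;c\}$ is a self-loop; a multi-edge is a collection of two or more edges (of different colors) with identical endpoints. $\mathscr G_{\rm drift}$ has: a Blue edge $\{i,j\}$ ($i\ne j$) iff $\mathrm{Re}([A_s]_{ij})=-\mathrm{Re}([A_s]_{ji})\ne0$ for some $s$; a Red edge $\{i,j\}$ ($i\ne j$) iff $\mathrm{Im}([A_s]_{ij})=\mathrm{Im}([A_s]_{ji})\ne0$ for some $s$; a Green self-loop $\{i,i\}$ iff $[A_s]_{ii}\ne0$ for some $s$. $\mathscr G_{\rm contr}$ has a Blue edge $\{i,j\}$ for each $B_{ij}\in\mathrm S_1$, a Red edge $\{i,j\}$ for each $C_{ij}\in\mathrm S_2$, and Green self-loops $\{i,i\},\{j,j\}$ for each $D_{ij}\in\mathrm S_3$. The union has node set $\mathrm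 V$ and the union of edge sets. A walk alternates nodes and edges with consecutive endpoints; a cycle is a closed walk; connected means any two nodes are joined by a walk; connected components are maximal connected subgraphs. For $\dot X=\mathsf B_0X+(\sum_{i=1}^m u_i\mathsf B_i)X$ on $\mathrm{SU}(n)$ (piecewise continuous real controls), controllable means every element of $\mathrm{SU}(n)$ is reachable from $X(0)=I$ at some time $T\ge0$; structurally controllable w.r.t. $(\Sigma_{\rm r}(\mathfrak g_\alpha),\Sigma_{\rm f}(\mathfrak g_\beta))$ means there exist $m\ge1$, $\mathsf B_0\in\Sigma_{\rm r}(\mathfrak g_\alpha)$, $\mathsf B_1,\dots,\mathsf B_m\in\Sigma_{\rm f}(\mathfrak g_\beta)$ making it controllable. *)

(* Defs.v *)
From HB Require Import structures.
From mathcomp Require Import all_boot all_order all_algebra.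
From mathcomp Require Import all_classical all_reals all_analysis.
From mathcomp Require Import complex.
Set Implicit Arguments. Unset Strict Implicit. Unset Printing Implicit Defensive.
Import Order.TTheory GRing.Theory Num.Theory.
Import numFieldNormedType.Exports.
Local Open Scope ring_scope.
Local Open Scope classical_set_scope.

Section Defs.
Variable R : realType.
Local Notation C := (complex R).

Definition cmx n := 'M[C]_n.

Definition adjmx n (A : 'M[C]_n) : 'M[C]_n := (map_mx (@conjc R) A)^T.

Definition in_su n (A : 'M[C]_n) : Prop := adjmx A = - A /\ \tr A = 0.

Definition in_SU n (X : 'M[C]_n) : Prop := X *m adjmx X = 1%:M /\ \det X = 1.

Definition Emx n (i j : 'I_n) : 'M[C]_n := delta_mx i j.
Definition Bmx n (i j : 'I_n) : 'M[C]_n := Emx i j - Emx j i.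
Definition Cmx n (i j : 'I_n) : 'M[C]_n := ('i%C : C) *: (Emx i j + Emx j i).
Definition Dmx n (i j : 'I_n) : 'M[C]_n := ('i%C : C) *: (Emx i i - Emx j j).

Definition rC (r : R) : C := (r%:C)%C.

Definition Sigma_f n (gs : seq 'M[C]_n) : set 'M[C]_n :=
  [set X | exists l : 'I_(size gs) -> R,
             X = \sum_(k < size gs) rC (l k) *: gs`_k].

Definition Sigma_r n d (A : 'I_d -> 'M[C]_n) : set 'M[C]_n :=
  [set X | exists l : 'I_d -> R, (forall s, l s != 0) /\
             X = \sum_(s < d) rC (l s) *: A s].

Inductive colour := Blue | Red | Green.
Definition colour_eqb (a b : colour) : bool :=
  match a, b with Blue, Blue | Red, Red | Green, Green => true | _, _ => false end.

(* blue i j / red i j : there is a Blue / Red edge {i,j};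
   green i : there is a Green self-loop {i,i}. *)
Record cgraph n := CGraph { blue : rel 'I_n; red : rel 'I_n; green : pred 'I_n }.

Definition has_edge n (G : cgraph n) (x y : 'I_n) (c : colour) : bool :=
  match c with
  | Blue => blue G x y
  | Red => red G x y
  | Green => (x == y) && green G x
  end.

Definition gunion n (G H : cgraph n) : cgraph n :=
  CGraph (fun x y => blue G x y || blue H x y)
         (fun x y => red G x y || red H x y)
         (fun x => green G x || green H x).

Definition adj n (G : cgraph n) : rel 'I_n :=
  fun x y => [|| has_edge G x y Blue, has_edge G x y Red | has_edge G x y Green].

Definition gconnected n (G : cgraph n) : Prop := forall x y, connect (adj G) x y.

Definition component n (G : cgraph n) (x : 'I_n) : {set 'I_n} :=
  [set y | connect (adj G) x y].

Definition no_multi_edge n (G : cgraph n) : Prop :=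
  forall x y c1 c2, has_edge G x y c1 -> has_edge G x y c2 -> c1 = c2.

Definition has_self_loop n (G : cgraph n) : Prop :=
  exists x c, has_edge G x x c.

(* a cycle (closed walk) x0 -c1- x1 -c2- ... -ck- xk = x0 (k >= 1), encoded by
   the start x0 and the list of steps (x_t, c_t), having an odd number of Red edges *)
Definition step_ok n (G : cgraph n) (p q : 'I_n * colour) : bool :=
  has_edge G p.1 q.1 q.2.

Definition has_odd_red_cycle n (G : cgraph n) : Prop :=
  exists (x0 : 'I_n) (c0 : colour) (s : seq ('I_n * colour)),
    [/\ (0 < size s)%N, path (step_ok G) (x0, c0) s,
        last x0 (map fst s) = x0 &
        odd (count (fun p => colour_eqb p.2 Red) s)].

Definition G_drift n d (A : 'I_d -> 'M[C]_n) : cgraph n :=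
  CGraph (fun i j => (i != j) &&
            [exists s, (complex.Re (A s i j) == - complex.Re (A s j i))
                       && (complex.Re (A s i j) != 0)])
         (fun i j => (i != j) &&
            [exists s, (complex.Im (A s i j) == complex.Im (A s j i))
                       && (complex.Im (A s i j) != 0)])
         (fun i => [exists s, A s i i != 0]).

(* G_contr : S1, S2, S3 are sets of index pairs (i,j), i<j, standing for the
   chosen B_ij, C_ij, D_ij *)
Definition G_contr n (S1 S2 S3 : {set 'I_n * 'I_n}) : cgraph n :=
  CGraph (fun i j => ((i, j) \in S1) || ((j, i) \in S1))
         (fun i j => ((i, j) \in S2) || ((j, i) \in S2))
         (fun k => [exists p in S3, (p.1 == k) || (p.2 == k)]).

Definition ctrl_gens n (S1 S2 S3 : {set 'I_n * 'I_n}) : seq 'M[C]_n :=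
  [seq Bmx p.1 p.2 | p <- enum S1] ++ [seq Cmx p.1 p.2 | p <- enum S2]
  ++ [seq Dmx p.1 p.2 | p <- enum S3].

Definition partition_of (T : R) (ts : seq R) : Prop :=
  [/\ head 0 ts = 0, last 0 ts = T, ts != [::] & sorted <%R ts].

Definition pieces (ts : seq R) : seq (R * R) := zip ts (behead ts).

Definition cont_piece (a b : R) (f : R -> R) : Prop :=
  exists g : R -> R, {within `[a, b], continuous g} /\
    (forall t, a < t < b -> f t = g t).

Definition reX n (X : 'M[C]_n) (i j : 'I_n) : R := complex.Re (X i j).
Definition imX n (X : 'M[C]_n) (i j : 'I_n) : R := complex.Im (X i j).

Definition solves_on n (a b : R) (F : R -> 'M[C]_n) (X : R -> 'M[C]_n) : Prop :=
  forall t, a < t < b -> forall i j,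
    is_derive t (1 : R) (fun s => reX (X s) i j) (reX (F t *m X t) i j) /\
    is_derive t (1 : R) (fun s => imX (X s) i j) (imX (F t *m X t) i j).

Definition reachable_at n m (B0 : 'M[C]_n) (Bs : 'I_m -> 'M[C]_n)
    (T : R) (Y : 'M[C]_n) : Prop :=
  exists (u : 'I_m -> R -> R) (X : R -> 'M[C]_n) (ts : seq R),
    [/\ partition_of T ts,
        (forall k, forall p, p \in pieces ts -> cont_piece p.1 p.2 (u k)),
        (forall i j, {within `[0, T], continuous (fun t => reX (X t) i j)} /\
                     {within `[0, T], continuous (fun t => imX (X t) i j)}),
        (forall p, p \in pieces ts ->
           solves_on p.1 p.2 (fun t => B0 + \sum_(k < m) rC (u k t) *: Bs k) X) &
        X 0 = 1%:M /\ X T = Y].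

Definition controllable_SU n m (B0 : 'M[C]_n) (Bs : 'I_m -> 'M[C]_n) : Prop :=
  forall Y, in_SU Y -> exists T, 0 <= T /\ reachable_at B0 Bs T Y.

Definition struct_controllable n d (A : 'I_d -> 'M[C]_n) (gens : seq 'M[C]_n) : Prop :=
  exists m : nat, (1 <= m)%N /\
    exists (B0 : 'M[C]_n) (Bs : 'I_m -> 'M[C]_n),
      [/\ Sigma_r A B0, (forall k, Sigma_f gens (Bs k)) & controllable_SU B0 Bs].

End Defs.

(* Main.v *)
Require Import Defs.
From HB Require Import structures.
From mathcomp Require Import all_boot all_order all_algebra.
From mathcomp Require Import all_classical all_reals all_analysis.
From mathcomp Require Import complex spectral.
From mathcomp Require Import ring lra.
Set Implicit Arguments. Unset Strict Implicit. Unset Printing Implicit Defensive.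
Import Order.TTheory GRing.Theory Num.Theory.
Import numFieldNormedType.Exports.
Local Open Scope ring_scope.

(** The drift is a generic combination of the [A_s], so that its nonzero entries
    are exactly those of the drift graph.  A Lie algebra containing it and the
    control generators contains, for two nodes [i], [j] joined by control edges,
    one of [B_ij], [C_ij]; since components have at least three nodes, squares of
    adjoint actions of these generators isolate single entries of the drift.
    First the entries joining distinct components are isolated, which gives a
    generator on every pair of nodes, then all entries; the self-loop or the odd
    cycle puts both [B_ij] and [C_ij] in the Lie algebra for some pair, and then
    it contains su(n).

    Let [S] be the semigroup generated by the flows of constant controls.  The span
    of the matrices [g^* A_u g] ([g] in [S], [A_u] the matrix of the control [u])
    is stable under brackets with each [A_u], so it contains su(n).  Hence some
    product of flows, as a function of its times, has at times 1 a derivative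
    carrying a basis of its parameter space to a basis of su(n).  Minimizing the
    distance to a target over a box of times shows that its image is a
    neighbourhood in SU(n): a critical point of [Re \tr] near 1 in SU(n) is 1.
    Powers of an element of SU(n) return close to 1, so [S] contains a
    neighbourhood of 1, and every element of SU(n) is a power of an element close
    to 1. *)

(** * Real Lie algebras of complex matrices and their off-diagonal generators *)

Section LieAlgebra.
Context {R : realType} {n : nat}.
Local Notation C := (complex R).
Local Notation M := 'M[C]_n.
Implicit Types (X Y T : M) (a b : C) (i j k : 'I_n).

Definition brk X Y : M := X *m Y - Y *m X.

Record lie_subalgebra (L : M -> Prop) : Prop := {
  lie0 : L 0;
  lieD : forall X Y, L X -> L Y -> L (X + Y);
  lieZ : forall (r : R) X, L X -> L (rC r *: X);
  lieB : forall X Y, L X -> L Y -> L (brk X Y) }.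

(** For [i != j], the skew-Hermitian matrix with entry [a] at [(i,j)] and support in [(i,j)],
    [(j,i)]. Phase [1] gives [B_ij] and phase ['i] gives [C_ij], so one bracket formula covers
    both. *)
Definition sk a i j : M := a *: Emx R i j - (a^*)%C *: Emx R j i.

Lemma conjcM a b : ((a * b)^*)%C = (a^*)%C * (b^*)%C.
Proof. exact: rmorphM. Qed.

Lemma conjcD a b : ((a + b)^*)%C = (a^*)%C + (b^*)%C.
Proof. exact: rmorphD. Qed.

Lemma conjcN a : ((- a)^*)%C = - (a^*)%C.
Proof. exact: rmorphN. Qed.

Lemma conjci : ('i^*)%C = - 'i%C :> C.
Proof. by apply/eqP; rewrite eq_complex /= oppr0 !eqxx. Qed.

Lemma Emx_mul i j k l : Emx R i j *m Emx R k l = (j == k)%:R *: Emx R i l.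
Proof.
rewrite /Emx; case: eqVneq => [->|jk]; first by rewrite mul_delta_mx scale1r.
by rewrite mul_delta_mx_0 // scale0r.
Qed.

Lemma Emx_sandwich X i j : Emx R i i *m X *m Emx R j j = X i j *: Emx R i j.
Proof.
(* Each [E_ii] factors as a column times a row, which reduces the middle product to the 1 by 1
   matrix [X i j]. *)
rewrite /Emx -(mul_delta_mx (0 : 'I_1) i i) -(mul_delta_mx (0 : 'I_1) j j).
rewrite -(mulmxA (delta_mx i 0)) -rowE -!mulmxA (mulmxA (row i X)) -colE.
have -> : col j (row i X) = (X i j)%:M.
  by apply/matrixP=> k l; rewrite !mxE !ord1 eqxx mulr1n.
by rewrite mul_scalar_mx -scalemxAr mul_delta_mx.
Qed.

Lemma sk_mul a b i j k l : sk a i j *m sk b k l =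
  (a * b * (j == k)%:R) *: Emx R i l - (a * (b^*)%C * (j == l)%:R) *: Emx R i k
  - ((a^*)%C * b * (i == k)%:R) *: Emx R j l
  + ((a^*)%C * (b^*)%C * (i == l)%:R) *: Emx R j k.
Proof.
rewrite /sk mulmxBl !mulmxBr -!scalemxAl -!scalemxAr !Emx_mul !scalerA.
by rewrite opprB addrA addrAC.
Qed.

Lemma sk_brk a b i j k : i != j -> j != k -> i != k ->
  brk (sk a i j) (sk b j k) = sk (a * b) i k.
Proof.
move=> ij jk ik; rewrite /brk !sk_mul ?eqxx [k == j]eq_sym [k == i]eq_sym.
rewrite [j == i]eq_sym (negbTE ij) (negbTE jk) (negbTE ik) !mulr0n !mulr1n.
rewrite !mulr0 !mulr1.
rewrite !scale0r !subr0 !addr0 /sk conjcM [(b^*)%C * _]mulrC.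
by rewrite add0r.
Qed.

Lemma sk_brk_same a b i j : i != j ->
  brk (sk a i j) (sk b i j) =
  (b * (a^*)%C - a * (b^*)%C) *: (Emx R i i - Emx R j j).
Proof.
move=> ij; rewrite /brk !sk_mul ?eqxx [j == i]eq_sym (negbTE ij).
rewrite !mulr0n !mulr1n !mulr0 !mulr1 !scale0r !addr0 !sub0r.
rewrite [(a^*)%C * b]mulrC [(b^*)%C * a]mulrC scalerBr !scalerBl.
rewrite opprD !opprK opprB addrACA; congr (_ + _); exact: addrC.
Qed.

Lemma sk_brk2 i j : i != j -> brk (sk 1 i j) (sk 'i%C i j) = rC 2 *: Dmx R i j.
Proof.
move=> ij; rewrite sk_brk_same // /Dmx scalerA; congr (_ *: _).
by rewrite /rC; simpc; congr Complex; rewrite !(mulr0, mul0r); lra.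
Qed.

Lemma skD a b i j : sk (a + b) i j = sk a i j + sk b i j.
Proof. by rewrite /sk conjcD !scalerDl opprD addrACA. Qed.

Lemma skZ (r : R) a i j : sk (rC r * a) i j = rC r *: sk a i j.
Proof. by rewrite /sk conjcM conjc_real scalerBr !scalerA. Qed.

Lemma sk_sym a i j : sk a j i = sk (- (a^*)%C) i j.
Proof. by rewrite /sk conjcN conjcK !scaleNr opprK addrC. Qed.

(** The phase cancels in the square: the projection onto two coordinates is available, up to sign,
    whatever the colour of the generator. *)
Lemma sk_sqr a i j : i != j -> a * (a^*)%C = 1 ->
  sk a i j *m sk a i j = - (Emx R i i + Emx R j j).
Proof.
move=> ij a1; rewrite sk_mul ?eqxx [j == i]eq_sym (negbTE ij).
rewrite !mulr0n !mulr1n !mulr0 !mulr1 !scale0r !sub0r addr0 [(a^*)%C * a]mulrC a1.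
by rewrite !scale1r opprD.
Qed.

Lemma sk_mul0 a b i j k l : i != k -> i != l -> j != k -> j != l ->
  sk a i j *m sk b k l = 0.
Proof.
move=> ik il jk jl; rewrite sk_mul (negbTE ik) (negbTE jk) (negbTE il).
by rewrite (negbTE jl) !mulr0n !mulr0 !scale0r !subr0 addr0.
Qed.

Lemma Bmx_sk i j : Bmx R i j = sk 1 i j.
Proof. by rewrite /sk conjc1 !scale1r. Qed.

Lemma Cmx_sk i j : Cmx R i j = sk 'i%C i j.
Proof.
by rewrite /sk /Cmx conjci scalerDr scaleNr opprK.
Qed.

Lemma Dmx_sk_brk b i j k : i != k -> j != k -> i != j ->
  brk (Dmx R i j) (sk b i k) = sk ('i%C * b) i k.
Proof.
move=> ik jk ij; rewrite /brk /sk /Dmx -scalemxAl -scalemxAr.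
rewrite !mulmxBl !mulmxBr -!scalemxAl -!scalemxAr.
rewrite !Emx_mul eqxx ![k == _]eq_sym (negbTE ik) (negbTE jk).
rewrite ![j == i]eq_sym (negbTE ij) !scale0r !scaler0 !scale1r !subr0.
rewrite sub0r scalerN opprK !scalerA conjcM conjci.
by rewrite mulNr scaleNr opprK.
Qed.

(** * Isolation of a single matrix entry inside a Lie subalgebra *)

Section Subalgebra.
Variable L : M -> Prop.
Hypothesis lieL : lie_subalgebra L.

Lemma lieN X : L X -> L (- X).
Proof.
by move=> /(lieZ lieL (-1)); rewrite /rC rmorphN1 scaleN1r.
Qed.

Lemma lie_sum (I : Type) (r : seq I) (P : pred I) (F : I -> M) :
  (forall x, P x -> L (F x)) -> L (\sum_(x <- r | P x) F x).
Proof. by move=> LF; apply: big_ind => //; [exact: lie0|exact: lieD]. Qed.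

Lemma lieZK (r : R) X : r != 0 -> L (rC r *: X) -> L X.
Proof.
move=> r0 /(lieZ lieL r^-1); rewrite scalerA /rC -rmorphM mulVf //.
by rewrite scale1r.
Qed.

Definition sandwich X Y Z : M := Y *m X *m Z + Z *m X *m Y.

Lemma sandwichNN X Y Z : sandwich X (- Y) (- Z) = sandwich X Y Z.
Proof. by rewrite /sandwich !(mulNmx, mulmxN) !opprK. Qed.

Lemma sandwichC X Y Z : sandwich X Y Z = sandwich X Z Y.
Proof. by rewrite /sandwich addrC. Qed.

Lemma sandwichDl X Y1 Y2 Z :
  sandwich X (Y1 + Y2) Z = sandwich X Y1 Z + sandwich X Y2 Z.
Proof. by rewrite /sandwich !mulmxDl !mulmxDr addrACA. Qed.

Lemma sandwichZl a X Y Z : sandwich X (a *: Y) Z = a *: sandwich X Y Z.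
Proof. by rewrite /sandwich -!scalemxAl -!scalemxAr scalerDr. Qed.

(* [sandwich X (T ^ 2) (T' ^ 2)] is [(ad T \o ad T') ^ 2] applied to [X]. *)
Lemma lie_sandwich X T T' : T *m T' = 0 -> T' *m T = 0 ->
  L X -> L T -> L T' -> L (sandwich X (T *m T) (T' *m T')).
Proof.
move=> TT' T'T LX LT LT'.
have E Y : brk T (brk T' Y) = - (T *m Y *m T' + T' *m Y *m T).
  rewrite /brk !mulmxBr !mulmxBl !mulmxA TT' mul0mx sub0r.
  by rewrite -[Y *m T' *m T]mulmxA T'T mulmx0 subr0 opprD.
have -> : sandwich X (T *m T) (T' *m T') = brk T (brk T' (brk T (brk T' X))).
  rewrite !E /sandwich !mulmxN !mulNmx -opprD opprK.
  rewrite !mulmxDr !mulmxDl !mulmxA TT' T'T !mul0mx.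
  by rewrite addr0 add0r -!mulmxA.
by do 4! apply: (lieB lieL) => //.
Qed.

Definition unitc a := a * (a^*)%C = 1.

(** Squares of generators on pairs in [{a, a1, a2}] give projections onto two coordinates, and the
    three of them combine linearly to [2 E_aa]; this is where three nodes on each side enter.
    Sandwiching [X] between [E_aa] and [E_bb] leaves its entries at [(a,b)] and [(b,a)], tied
    together by skewness. *)
Lemma lie_extract X (a a1 a2 b b1 b2 : 'I_n) : adjmx X = - X ->
  uniq [:: a; a1; a2; b; b1; b2] ->
  (forall i j, i != j -> i \in [:: a; a1; a2] -> j \in [:: a; a1; a2] ->
     exists c, unitc c /\ L (sk c i j)) ->
  (forall i j, i != j -> i \in [:: b; b1; b2] -> j \in [:: b; b1; b2] ->
     exists c, unitc c /\ L (sk c i j)) ->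
  L X -> L (sk (X a b) a b).
Proof.
move=> Xsk U La Lb LX.
have pj i j k l : i != j -> k != l -> i \in [:: a; a1; a2] ->
    j \in [:: a; a1; a2] -> k \in [:: b; b1; b2] -> l \in [:: b; b1; b2] ->
    L (sandwich X (Emx R i i + Emx R j j) (Emx R k k + Emx R l l)).
  move=> ij kl ia ja kb lb.
  have [c [c1 Lc]] := La _ _ ij ia ja; have [d [d1 Ld]] := Lb _ _ kl kb lb.
  have disj u v : u \in [:: a; a1; a2] -> v \in [:: b; b1; b2] -> u != v.
    move: U; rewrite -[[:: a; a1; a2; b; b1; b2]]/([:: a; a1; a2] ++ _).
    rewrite cat_uniq => /and3P[_ /hasPn U _] ua vb; apply/eqP => uv.
    by move: (U v vb); rewrite /= -uv ua.
  have disj' u v : u \in [:: a; a1; a2] -> v \in [:: b; b1; b2] -> v != u.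
    by rewrite eq_sym; apply: disj.
  (* Both squares carry a minus sign, and the two signs cancel. The generators live on disjoint
     pairs, so their products vanish as [lie_sandwich] requires. *)
  rewrite -sandwichNN -(sk_sqr ij c1) -(sk_sqr kl d1).
  by apply: lie_sandwich => //; apply: sk_mul0; (exact: disj || exact: disj').
have two (i j k : 'I_n) : rC 2 *: Emx R i i = (Emx R i i + Emx R j j) +
    (Emx R i i + Emx R k k) + rC (-1) *: (Emx R j j + Emx R k k).
  rewrite /rC rmorphN1 scaleN1r addrACA [Emx R j j + _ in RHS]addrC.
  rewrite [Emx R k k + _]addrC addrK.
  by rewrite -[2]/(1 + 1) rmorphD scalerDl rmorph1 scale1r.
have half k l : k != l -> k \in [:: b; b1; b2] -> l \in [:: b; b1; b2] ->
   L (sandwich X (rC 2 *: Emx R a a) (Emx R k k + Emx R l l)).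
  move=> kl kb lb; move: U; rewrite /= !inE !negb_or -!andbA.
  move=> /and5P[aa1 aa2 _ _] /and5P[_ a12 _ _ _].
  rewrite (two a a1 a2) 2!sandwichDl sandwichZl; apply: (lieD lieL).
    by apply: (lieD lieL); apply: pj; rewrite // !inE eqxx ?orbT.
  by apply: (lieZ lieL); apply: pj; rewrite // !inE eqxx ?orbT.
have : L (sandwich X (rC 2 *: Emx R b b) (rC 2 *: Emx R a a)).
  move: U; rewrite /= !inE !negb_or => /and5P[_ _ _ /andP[bb1 bb2]].
  move=> /andP[b12 _].
  rewrite (two b b1 b2) 2!sandwichDl sandwichZl; apply: (lieD lieL).
    by apply: (lieD lieL); rewrite sandwichC; apply: half; rewrite // !inE eqxx ?orbT.
  by apply: (lieZ lieL); rewrite sandwichC; apply: half; rewrite // !inE eqxx ?orbT.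
rewrite sandwichZl sandwichC sandwichZl /sandwich !Emx_sandwich.
have n2 : (2 : R) != 0 by rewrite pnatr_eq0.
move=> /(lieZK n2)/(lieZK n2).
have -> : X b a = - ((X a b)^*)%C.
  by move/matrixP: Xsk => /(_ b a); rewrite !mxE => ->; rewrite opprK.
by rewrite scaleNr.
Qed.
End Subalgebra.
End LieAlgebra.

(** * Blue and Red generators, and how their colours combine *)

Section ColouredGenerators.
Context {R : realType} {n : nat}.
Local Notation C := (complex R).
Local Notation M := 'M[C]_n.
Variable L : M -> Prop.
Hypothesis lieL : lie_subalgebra L.

(* [c = true] stands for Red: [sk (phase c) i j] is [C_ij] if [c], else [B_ij]. *)
Definition phase (c : bool) : C := if c then 'i%C else 1.

Definition coloured (c : bool) (i j : 'I_n) := L (sk (phase c) i j).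

Lemma rC1 : rC (1 : R) = 1. Proof. by rewrite /rC rmorph1. Qed.
Lemma rCN1 : rC (-1 : R) = -1. Proof. by rewrite /rC rmorphN1. Qed.

Lemma mulii : 'i%C * 'i%C = -1 :> C.
Proof. by rewrite -expr2 sqr_i. Qed.

Lemma phase_unit c : unitc (phase c).
Proof.
by case: c; rewrite /unitc /phase ?conjci ?conjc1 ?mulr1 // mulrN mulii opprK.
Qed.

(** Modulo nonzero real factors the phases [1] and ['i] form a group of order two. Hence colours add
    modulo 2 under brackets, and only the parity of Red edges matters along a walk. *)
Lemma phase_mul c c' : exists r : R, r != 0 /\ phase c * phase c' = rC r * phase (c (+) c').
Proof.
case: c; case: c'; rewrite /= ?mulr1 ?mul1r ?mulii.
- by exists (-1); rewrite rCN1 mulr1 oppr_eq0 oner_eq0; split.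
- by exists 1; rewrite rC1 mul1r oner_eq0; split.
- by exists 1; rewrite rC1 mul1r oner_eq0; split.
- by exists 1; rewrite rC1 mulr1 oner_eq0; split.
Qed.

Lemma coloured_sym c i j : coloured c i j -> coloured c j i.
Proof.
rewrite /coloured (sk_sym _ i j); case: c; rewrite /phase.
  by rewrite conjci opprK.
by rewrite conjc1 -[-1]mulr1 -rCN1 skZ; apply: lieZ.
Qed.

Lemma coloured_mul z c i j (r : R) : r != 0 -> z = rC r * phase c ->
  L (sk z i j) -> coloured c i j.
Proof. by move=> r0 ->; rewrite skZ => /(lieZK lieL r0). Qed.

Lemma coloured_trans c c' i j k : i != j -> j != k -> i != k ->
  coloured c i j -> coloured c' j k -> coloured (c (+) c') i k.
Proof.
move=> ij jk ik Lij Ljk; have [r [r0 E]] := phase_mul c c'.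
by apply: (coloured_mul r0 E); rewrite -(sk_brk _ _ ij jk ik); apply: lieB.
Qed.

(** Brackets are composed along the walk. The bracket formula needs three distinct indices, so
    coincidences with an endpoint are treated apart. *)
Lemma coloured_connect (e : rel 'I_n) :
  (forall x y, e x y -> x != y -> exists c, coloured c x y) ->
  forall x y, connect e x y -> x != y -> exists c, coloured c x y.
Proof.
move=> He x y /connectP[p]; elim: p x y => [|z p IH] x y /=.
  by move=> _ ->; rewrite eqxx.
move=> /andP[exz zp] yE xy.
have [xz|xz] := eqVneq x z; first by subst z; apply: IH xy.
have [c Lc] := He _ _ exz xz.
have [zy|zy] := eqVneq z y; first by subst z; exists c.
have [c' Lc'] := IH _ _ zp yE zy.
by exists (c (+) c'); apply: coloured_trans Lc Lc'.
Qed.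

Lemma sk_sum (X : M) : \sum_i \sum_j sk (X i j) i j = X - adjmx X.
Proof.
have adjE : adjmx X = \sum_i \sum_j ((X i j)^*)%C *: Emx R j i.
  rewrite [LHS]matrix_sum_delta exchange_big /=.
  by apply: eq_bigr => i _; apply: eq_bigr => j _; rewrite !mxE.
rewrite adjE {2}[X]matrix_sum_delta /sk -sumrB.
by apply: eq_bigr => i _; rewrite -sumrB.
Qed.

Definition bicoloured i j := i != j /\ forall c, coloured c i j.

Lemma sk_real_comb (z : C) (i j : 'I_n) : sk z i j =
  rC (complex.Re z) *: sk 1 i j + rC (complex.Im z) *: sk 'i%C i j.
Proof.
rewrite -!skZ -skD mulr1 {1}[z]complexE; congr (sk (_ + _) i j).
exact: mulrC.
Qed.

Lemma skew_diag_Re (X : M) i : adjmx X = - X -> complex.Re (X i i) = 0.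
Proof.
move/matrixP => /(_ i i); rewrite !mxE.
case: (X i i) => a b /eqP; rewrite eq_complex /= => /andP[/eqP aN _].
by lra.
Qed.

(** The diagonal entries are purely imaginary, and the multiple of [E_rr] subtracted in total is the
    trace. *)
Lemma Dmx_sum (X : M) (r : 'I_n) : adjmx X = - X -> \tr X = 0 ->
  \sum_i rC (complex.Im (X i i)) *: Dmx R i r = \sum_i X i i *: Emx R i i.
Proof.
move=> Xsk trX.
have XE i : rC (complex.Im (X i i)) * 'i%C = X i i.
  rewrite {2}[X i i]complexE (skew_diag_Re i Xsk) /rC rmorph0 add0r.
  exact: mulrC.
rewrite /Dmx; under eq_bigr => i _ do rewrite scalerA XE scalerBr.
rewrite sumrB -scaler_suml [X in X *: _](_ : _ = 0) ?scale0r ?subr0 //.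
Qed.

Lemma sk_diag (X : M) i : adjmx X = - X ->
  sk (X i i) i i = rC 2 *: (X i i *: Emx R i i).
Proof.
move=> /matrixP/(_ i i); rewrite !mxE /sk => ->.
rewrite scaleNr opprK -[2]/(1 + 1) /rC rmorphD rmorph1 scalerDl.
by rewrite scale1r.
Qed.

(** A sum over ordered pairs counts each off-diagonal entry twice, whence the factor 2. *)
Lemma sk_sum_skew (X : M) : adjmx X = - X ->
  rC 2 *: X = rC 2 *: (\sum_i X i i *: Emx R i i)
    + \sum_i \sum_(j | j != i) sk (X i j) i j.
Proof.
move=> Xsk; rewrite scaler_sumr -big_split /=.
transitivity (\sum_i \sum_j sk (X i j) i j).
  rewrite sk_sum Xsk opprK -[2]/(1 + 1) /rC rmorphD rmorph1 scalerDl.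
  by rewrite scale1r.
by apply: eq_bigr => i _; rewrite (bigD1 i) //= sk_diag.
Qed.

Lemma lie_Dmx i j : bicoloured i j -> L (Dmx R i j).
Proof.
move=> [ij bi]; have n2 : (2 : R) != 0 by rewrite pnatr_eq0.
apply: (lieZK lieL n2); rewrite -sk_brk2 //.
by apply: (lieB lieL); [exact: (bi false)|exact: (bi true)].
Qed.

Lemma su_of_bicoloured : (forall i j, i != j -> bicoloured i j) ->
  forall X : M, in_su X -> L X.
Proof.
(* The diagonal part is expanded in the [D_ir] for a reference node [r]; without any node all
   matrices are equal. *)
move=> bi X [Xsk trX]; case: (pickP (@predT 'I_n)) => [r _|no]; last first.
  rewrite (_ : X = 0); first exact: lie0.
  by apply/matrixP => i; have := no i.
have n2 : (2 : R) != 0 by rewrite pnatr_eq0.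
apply: (lieZK lieL n2); rewrite sk_sum_skew // -(Dmx_sum r) //.
apply: (lieD lieL).
  apply: (lieZ lieL); apply: (lie_sum lieL) => i _; apply: (lieZ lieL).
  have [->|ir] := eqVneq i r; last exact/lie_Dmx/bi.
  by rewrite /Dmx subrr scaler0; exact: lie0.
apply: (lie_sum lieL) => i _; apply: (lie_sum lieL) => j ji.
rewrite eq_sym in ji; rewrite sk_real_comb; have [_ bij] := bi _ _ ji.
by apply: (lieD lieL); apply: (lieZ lieL); [exact: (bij false)|exact: (bij true)].
Qed.

Hypothesis complete : forall i j, i != j -> exists c, coloured c i j.

(** The bracket with [D_ij] multiplies the phase by ['i], which switches the colour. *)
Lemma coloured_rot c i j k : i != j -> j != k -> i != k ->
  L (Dmx R i j) -> coloured c i k -> coloured (~~ c) i k.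
Proof.
move=> ij jk ik LD Lc; have [r [r0 E]] := phase_mul true c.
by apply: (coloured_mul r0 E); rewrite -(Dmx_sk_brk _ ik jk ij); apply: lieB.
Qed.

Lemma bicoloured_Dmx i j k : i != j -> j != k -> i != k ->
  L (Dmx R i j) -> bicoloured i k.
Proof.
move=> ij jk ik LD; split=> // c; have [c' Lc'] := complete ik.
have [<- //|cc'] := eqVneq c' c.
have -> : c = ~~ c' by case: c c' cc' {Lc'} => [] [].
exact: coloured_rot LD Lc'.
Qed.

Lemma bicoloured_sym i j : bicoloured i j -> bicoloured j i.
Proof. by move=> [ij bi]; split=> [|c]; [rewrite eq_sym|exact: coloured_sym]. Qed.

(** The bicoloured pair yields [D] on [i0], [j0], which switches the colour of the generator joining
    [i0] to any third node. Every remaining pair is then composed through [i0], with a free choice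
    of colour on one leg. *)
Lemma su_of_one_bicoloured i0 j0 : bicoloured i0 j0 ->
  forall X : M, in_su X -> L X.
Proof.
move=> b0; have star k : k != i0 -> bicoloured i0 k.
  move=> ki; have [<- //|jk] := eqVneq j0 k.
  have [ij _] := b0; apply: (bicoloured_Dmx ij jk); first by rewrite eq_sym.
  exact: lie_Dmx.
apply: su_of_bicoloured => i j ij.
have [ii0|ii0] := eqVneq i i0.
  by rewrite ii0 eq_sym in ij *; apply: star.
have [ji0|ji0] := eqVneq j i0.
  by rewrite ji0 in ij *; apply/bicoloured_sym/star.
split=> // c; have [_ bi] := bicoloured_sym (star i ii0).
have [i0j bj] := star j ji0; rewrite -[c]addbF.
exact: coloured_trans ii0 i0j ij (bi c) (bj false).
Qed.

Lemma diag_mx_Emx (d : 'rV[C]_n) i j :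
  diag_mx d *m Emx R i j = d 0 i *: Emx R i j.
Proof.
apply/matrixP=> k l; rewrite mul_diag_mx !mxE.
by case: eqVneq => [->//|_]; rewrite !mulr0.
Qed.

Lemma Emx_diag_mx (d : 'rV[C]_n) i j :
  Emx R i j *m diag_mx d = d 0 j *: Emx R i j.
Proof.
apply/matrixP=> k l; rewrite mul_mx_diag !mxE mulrC.
by case: (eqVneq l j) => [->//|_]; rewrite andbF !mulr0.
Qed.

Lemma diag_mx_sk_brk (d : 'rV[C]_n) z i j : (forall k, ((d 0 k)^*)%C = - d 0 k) ->
  brk (diag_mx d) (sk z i j) = sk ((d 0 i - d 0 j) * z) i j.
Proof.
move=> dI; rewrite /brk /sk mulmxBr mulmxBl -!scalemxAl -!scalemxAr.
rewrite !diag_mx_Emx !Emx_diag_mx !scalerA conjcM conjcD conjcN !dI opprK.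
rewrite [in RHS]mulrBl [_ * z]mulrC [_ * z]mulrC [in RHS]scalerBl.
rewrite [in RHS]mulrDl mulNr [in RHS]scalerDl scaleNr opprD opprK.
rewrite ![_ * (z^*)%C]mulrC opprD opprK -!addrA; congr (_ + _).
by rewrite addrCA; congr (_ + _); exact: addrC.
Qed.

(** The bracket with an imaginary diagonal matrix multiplies the phase by [d 0 i - d 0 j], a nonzero
    real multiple of ['i]. This switches the colour of the generator supplied by [complete]. *)
Lemma bicoloured_diag (d : 'rV[C]_n) i j :
  (forall k, ((d 0 k)^*)%C = - d 0 k) -> d 0 i != d 0 j ->
  L (diag_mx d) -> bicoloured i j.
Proof.
move=> dI dij Ld; have ij : i != j by apply: contraNneq dij => ->.
have [r [r0 dE]] : exists r : R, r != 0 /\ d 0 i - d 0 j = rC r * phase true.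
  exists (complex.Im (d 0 i - d 0 j)).
  have E : d 0 i - d 0 j = rC (complex.Im (d 0 i - d 0 j)) * 'i%C.
    have : ((d 0 i - d 0 j)^*)%C = - (d 0 i - d 0 j).
      by rewrite conjcD conjcN !dI opprB opprK addrC.
    case: (d 0 i - d 0 j) => a b /eqP; rewrite eq_complex /=.
    move=> /andP[/eqP aN _]; have -> : a = 0 by lra.
    by rewrite /rC; simpc.
  split=> //; apply: contraNneq dij => I0; rewrite -subr_eq0 E I0.
  by rewrite /rC rmorph0 mul0r.
have [c Lc] := complete ij; split=> // c'.
have [<- //|cc'] := eqVneq c c'.
have -> : c' = true (+) c by case: c c' cc' {Lc} => [] [].
have [s [s0 E]] := phase_mul true c.
apply: (@coloured_mul ((d 0 i - d 0 j) * phase c) _ _ _ (r * s)).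
- by rewrite mulf_neq0.
- by rewrite dE -mulrA E mulrA /rC rmorphM.
- by rewrite -diag_mx_sk_brk //; apply: (lieB lieL).
Qed.
End ColouredGenerators.

(** * The graph conditions force the Lie algebra to contain su(n) *)

Section GraphCriterion.
Context {R : realType} {n : nat}.
Local Notation C := (complex R).
Local Notation M := 'M[C]_n.
Variables (L : M -> Prop) (Gd : cgraph n) (S1 S2 S3 : {set 'I_n * 'I_n}) (B0 : M).
Local Notation Gc := (G_contr S1 S2 S3).
Hypotheses (lieL : lie_subalgebra L) (LB0 : L B0) (B0su : in_su B0).
Hypothesis S1lt : forall p, p \in S1 -> (p.1 < p.2)%N.
Hypothesis S2lt : forall p, p \in S2 -> (p.1 < p.2)%N.
Hypothesis S3lt : forall p, p \in S3 -> (p.1 < p.2)%N.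
Hypothesis L1 : forall p, p \in S1 -> L (Bmx R p.1 p.2).
Hypothesis L2 : forall p, p \in S2 -> L (Cmx R p.1 p.2).
Hypothesis L3 : forall p, p \in S3 -> L (Dmx R p.1 p.2).
(** The drift graph is seen only through [B0]: on a Blue edge the entry is a nonzero real, on a Red
    edge a nonzero imaginary number. This exclusivity is where the absence of multi-edges enters. *)
Hypothesis blue_drift : forall i j, blue Gd i j ->
  i != j /\ exists r : R, r != 0 /\ B0 i j = rC r * phase false.
Hypothesis red_drift : forall i j, red Gd i j ->
  i != j /\ exists r : R, r != 0 /\ B0 i j = rC r * phase true.
Hypothesis green_drift : forall i, green Gd i -> B0 i i != 0.
Hypothesis contr_disconnected : ~ gconnected Gc.
Hypothesis component_ge3 : forall x, (3 <= #|component Gc x|)%N.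
Hypothesis union_connected : gconnected (gunion Gd Gc).
Hypothesis loop_or_odd : has_self_loop (gunion Gd Gc) \/
  has_odd_red_cycle (gunion Gd Gc).

Lemma adj_contr_sym : symmetric (adj Gc).
Proof.
move=> x y; rewrite /adj /=; congr [|| _, _ | _]; rewrite 1?orbC //.
by rewrite eq_sym; case: eqVneq => // ->.
Qed.

Lemma connect_contr_sym x y : connect (adj Gc) x y = connect (adj Gc) y x.
Proof. exact/sym_connect_sym/adj_contr_sym. Qed.

Lemma blue_contr i j : blue Gc i j -> i != j /\ coloured L false i j.
Proof.
move=> /= /orP[] h; have /= lt := S1lt h; have := L1 h; rewrite Bmx_sk /= => Lh.
  by split=> //; rewrite -val_eqE /= ltn_eqF.
split; last exact: (coloured_sym lieL).
by rewrite -val_eqE /= gtn_eqF.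
Qed.

Lemma red_contr i j : red Gc i j -> i != j /\ coloured L true i j.
Proof.
move=> /= /orP[] h; have /= lt := S2lt h; have := L2 h; rewrite Cmx_sk /= => Lh.
  by split=> //; rewrite -val_eqE /= ltn_eqF.
split; last exact: (coloured_sym lieL).
by rewrite -val_eqE /= gtn_eqF.
Qed.

Lemma coloured_contr x y : connect (adj Gc) x y -> x != y ->
  exists c, coloured L c x y.
Proof.
apply: (coloured_connect lieL) => {}x {}y /or3P[] /=.
- by move=> /blue_contr[_ ?] _; exists false.
- by move=> /red_contr[_ ?] _; exists true.
- by move=> /andP[/eqP-> _]; rewrite eqxx.
Qed.

Lemma component_triple a : exists a1 a2, uniq [:: a; a1; a2] /\
  (forall x, x \in [:: a; a1; a2] -> connect (adj Gc) a x).
Proof.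
have := component_ge3 a; rewrite (cardsD1 a) inE connect0 add1n ltnS.
move=> /card_gt1P[a1 [a2 []]]; rewrite !inE => /andP[a1a c1] /andP[a2a c2] a12.
exists a1, a2; split.
  by rewrite /= !inE negb_or ![a == _]eq_sym a1a a2a a12.
by move=> x; rewrite !inE => /or3P[] /eqP->.
Qed.

(** Each endpoint is completed to a triple inside its own component. The two components are
    disjoint, so [lie_extract] applies with control generators alone. *)
Lemma lie_extract_cross a b : ~~ connect (adj Gc) a b -> L (sk (B0 a b) a b).
Proof.
move=> nab; have [a1 [a2 [Ua Ca]]] := component_triple a.
have [b1 [b2 [Ub Cb]]] := component_triple b.
have in_comp x (s : seq 'I_n) : (forall y, y \in s -> connect (adj Gc) x y) ->
    forall i j, i != j -> i \in s -> j \in s ->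
    exists c, unitc c /\ L (sk c i j).
  move=> Cs i j ij is_ js; have [|c Lc] := @coloured_contr i j _ ij.
    apply: connect_trans (Cs j js); rewrite connect_contr_sym; exact: Cs.
  by exists (phase c); split=> //; exact: phase_unit.
case: B0su => Bsk _.
apply: (lie_extract lieL (a1 := a1) (a2 := a2) (b1 := b1) (b2 := b2)) => //.
- rewrite -[[:: a; a1; a2; b; b1; b2]]/([:: a; a1; a2] ++ [:: b; b1; b2]).
  rewrite cat_uniq Ua Ub andbT; apply/hasPn => x xb; apply/negP => xa.
  move/negP: nab; apply; apply: connect_trans (Ca x xa) _.
  by rewrite connect_contr_sym; exact: Cb.
- exact: in_comp Ca.
- exact: in_comp Cb.
Qed.

(** Within a component control generators suffice. An edge of the union between two components comes
    from the drift, and the isolated entry is a generator of its colour. *)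
Lemma coloured_all i j : i != j -> exists c, coloured L c i j.
Proof.
move: (union_connected i j); apply: (coloured_connect lieL) => x y.
have [xy _|nxy] := boolP (connect (adj Gc) x y); first exact: coloured_contr.
have nadj : ~~ adj Gc x y by apply: contra nxy => /connect1.
move: nadj; rewrite /adj !negb_or => /and3P[nb nr _] /or3P[] /=.
- move=> /orP[|h]; last by rewrite -negb_or h in nb.
  move=> /blue_drift[_ [r [r0 E]]] _; exists false.
  by apply: (coloured_mul lieL r0 E); exact: lie_extract_cross.
- move=> /orP[|h]; last by rewrite -negb_or h in nr.
  move=> /red_drift[_ [r [r0 E]]] _; exists true.
  by apply: (coloured_mul lieL r0 E); exact: lie_extract_cross.
- by move=> /andP[/eqP-> _]; rewrite eqxx.
Qed.

(** Disconnectedness gives two disjoint components. Six nodes are what [lie_extract] needs around an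
    arbitrary pair. *)
Lemma nodes_ge6 : (6 <= n)%N.
Proof.
have [x [y nxy]] : exists x y, ~~ connect (adj Gc) x y.
  apply: contrapT => nex; apply: contr_disconnected => x y.
  by apply: contrapT => /negP nxy; apply: nex; exists x, y.
have dis : component Gc x :&: component Gc y = finset.set0.
  apply/finset.setP => z; rewrite !inE; apply/negP => /andP[xz yz].
  move/negP: nxy; apply; apply: connect_trans xz _.
  by rewrite connect_contr_sym.
have := leq_add (component_ge3 x) (component_ge3 y).
rewrite -cardsUI dis cards0 addn0.
by move=> h; apply: leq_trans h _; rewrite -[X in (_ <= X)%N]card_ord max_card.
Qed.

(** Every pair of nodes now carries some generator, so the four auxiliary nodes can be any nodes
    other than [a] and [b], regardless of components. *)
Lemma lie_extract_all a b : a != b -> L (sk (B0 a b) a b).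
Proof.
move=> ab; case: B0su => Bsk _.
have : (4 <= size (enum (~: [set a; b])))%N.
  rewrite -cardE cardsCs finset.setCK card_ord cards2 ab.
  by rewrite leq_subRL ?(leq_trans _ nodes_ge6).
have Us : uniq (enum (~: [set a; b])) by exact: enum_uniq.
have sP x : x \in enum (~: [set a; b]) -> (x != a) && (x != b).
  by rewrite mem_enum !inE negb_or.
case: (enum _) Us sP => [//|a1 [//|a2 [//|b1 [//|b2 s]]]].
rewrite -[_ :: _]/([:: a1; a2; b1; b2] ++ s) cat_uniq => /andP[Us _] sP _.
have {}sP x : x \in [:: a1; a2; b1; b2] -> (x != a) && (x != b).
  by move=> xs; apply: sP; rewrite mem_cat xs.
have any (s' : seq 'I_n) i j : i != j -> i \in s' -> j \in s' ->
    exists c, unitc c /\ L (sk c i j).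
  move=> ij _ _; have [c Lc] := coloured_all ij.
  by exists (phase c); split=> //; exact: phase_unit.
apply: (lie_extract lieL (a1 := a1) (a2 := a2) (b1 := b1) (b2 := b2)) => //;
  try exact: any.
have /andP[a1a a1b] := sP a1 (mem_head _ _).
have /andP[a2a a2b] : (a2 != a) && (a2 != b) by apply: sP; rewrite !inE eqxx ?orbT.
have /andP[b1a b1b] : (b1 != a) && (b1 != b) by apply: sP; rewrite !inE eqxx ?orbT.
have /andP[b2a b2b] : (b2 != a) && (b2 != b) by apply: sP; rewrite !inE eqxx ?orbT.
move: Us; rewrite /= !inE !negb_or -!andbA.
move=> /and5P[a12 -> -> a2b1 /and3P[-> -> _]].
by rewrite a12 a2b1 ab a1b a2b ![a == _]eq_sym a1a a2a b1a b2a ![b == _]eq_sym b1b b2b.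
Qed.

(** With all drift entries isolated, a drift edge inside a control component also yields a generator
    of its own colour. *)
Lemma coloured_union x y c : has_edge (gunion Gd Gc) x y c ->
  match c with
  | Green => x = y
  | _ => x != y /\ coloured L (colour_eqb c Red) x y
  end.
Proof.
case: c => /=.
- move=> /orP[/blue_drift[xy [r [r0 E]]]|]; last exact: blue_contr.
  by split=> //; apply: (coloured_mul lieL r0 E); exact: lie_extract_all.
- move=> /orP[/red_drift[xy [r [r0 E]]]|]; last exact: red_contr.
  by split=> //; apply: (coloured_mul lieL r0 E); exact: lie_extract_all.
- by move=> /andP[/eqP].
Qed.

(* Along a walk from [x0] to [x], composing brackets puts in [L] the generator
   on the pair [x0], [x] whose colour is the parity of the red edges. *)
Lemma odd_walk_bicoloured x0 c0 s : path (step_ok (gunion Gd Gc)) (x0, c0) s ->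
  let x := last x0 (map fst s) in
  let par := odd (count (fun p => colour_eqb p.2 Red) s) in
  (exists i j, bicoloured L i j) \/
  (if x == x0 then ~~ par : Prop else coloured L par x0 x).
Proof.
elim/last_ind: s => [_|s [y c] IH] /=; first by rewrite eqxx; right.
rewrite rcons_path => /andP[/IH{}IH]; rewrite map_rcons last_rcons.
rewrite -cats1 count_cat /= addn0 oddD /step_ok /=.
have -> : (last (x0, c0) s).1 = last x0 (map fst s) by exact: (esym (last_map fst s (x0, c0))).
move: IH => /=; move: (last x0 _) => x; move: (odd (count _ s)) => par IH e.
case: IH => [|IH]; first by left.
have bi i j c1 c2 : i != j -> c1 != c2 -> coloured L c1 i j ->
    coloured L c2 i j -> bicoloured L i j.
  move=> ij c12 h1 h2; split=> // c3.
  have [-> //|c31] := eqVneq c3 c1.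
  have -> // : c3 = c2.
  by clear -c12 c31; case: c1 c2 c3 c12 c31 => [] [] [].
have := coloured_union e; case: c e => /= e.
- move=> [xy cxy]; rewrite addbF.
  (* The walk closes at [x0]: either the composed generator and the last edge have opposite colours,
     and the pair is bicoloured, or the total parity is even. *)
  have [yx0|yx0] := eqVneq y x0.
    subst y; move: IH; rewrite (negbTE xy) => IH.
    case: par IH => IH; last by right.
    left; exists x0, x; apply: (bi _ _ true false _ _ IH) => //; first by rewrite eq_sym.
    exact: (coloured_sym lieL cxy).
  move: IH; have [xx0|xx0] := eqVneq x x0 => IH.
    by subst x; right; rewrite (negbTE IH).
  right; rewrite -[par]addbF; apply: (coloured_trans lieL) IH cxy => //; by rewrite eq_sym.
- move=> [xy cxy]; rewrite addbT.
  have [yx0|yx0] := eqVneq y x0.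
    subst y; move: IH; rewrite (negbTE xy) => IH.
    case: par IH => IH; first by right.
    left; exists x0, x; apply: (bi _ _ false true _ _ IH) => //; first by rewrite eq_sym.
    exact: (coloured_sym lieL cxy).
  move: IH; have [xx0|xx0] := eqVneq x x0 => IH.
    by subst x; right; rewrite (negbTE IH).
  right; rewrite -addbT; apply: (coloured_trans lieL) IH cxy => //; by rewrite eq_sym.
- by move=> <-; rewrite addbF; right.
Qed.

(** A control loop gives some [D_ij], which makes [i] and any third node bicoloured. For a drift
    loop, subtracting the isolated off-diagonal entries leaves the diagonal of the drift in [L];
    being traceless with a nonzero entry, it is not scalar, so it switches the colour of some
    generator. *)
Lemma green_union_bicoloured x : green (gunion Gd Gc) x ->
  exists i j, bicoloured L i j.
Proof.
case: (B0su) => Bsk trB /= /orP[/green_drift Bxx|/existsP[p /andP[pS _]]]; last first.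
  have LD := L3 pS; have /= lt := S3lt pS.
  have p12 : p.1 != p.2 by rewrite -val_eqE /= ltn_eqF.
  have [k /andP[k1 k2]] : exists k, (p.1 != k) && (p.2 != k).
    have : (0 < #|~: [set p.1; p.2]|)%N.
      by rewrite cardsCs finset.setCK card_ord cards2 p12 subn_gt0 (leq_trans _ nodes_ge6).
    by move=> /card_gt0P[k]; rewrite !inE negb_or ![k == _]eq_sym; exists k.
  by exists p.1, k; apply: (bicoloured_Dmx lieL coloured_all p12 k2 k1 LD).
pose d := \row_i B0 i i.
have Ld : L (diag_mx d).
  have n2 : (2 : R) != 0 by rewrite pnatr_eq0.
  apply: (lieZK lieL n2); have := sk_sum_skew Bsk.
  rewrite -[\sum_i B0 i i *: _](_ : diag_mx d = _); last first.
    by rewrite diag_mx_sum_delta; apply: eq_bigr => i _; rewrite mxE.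
  move=> /(canLR (addrK _)) <-; apply: (lieD lieL); first exact: (lieZ lieL).
  apply: (lieN lieL); apply: (lie_sum lieL) => i _; apply: (lie_sum lieL) => j ji.
  by apply: lie_extract_all; rewrite eq_sym.
have dI k : ((d 0 k)^*)%C = - d 0 k.
  by rewrite mxE; move/matrixP: Bsk => /(_ k k); rewrite !mxE.
have [j dj] : exists j, d 0 x != d 0 j.
  apply: contrapT => nex; move/eqP: Bxx; apply.
  have dE j : B0 j j = B0 x x.
    apply: contrapT => h; apply: nex; exists j; rewrite !mxE eq_sym.
    exact/eqP.
  move: trB; rewrite /mxtrace; under eq_bigr => j _ do rewrite dE.
  rewrite sumr_const card_ord => /eqP; rewrite mulrn_eq0.
  by rewrite eqn0Ngt (leq_trans _ nodes_ge6) //= => /eqP.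
by exists x, j; exact: (bicoloured_diag lieL coloured_all dI dj Ld).
Qed.

Theorem lie_contains_su X : in_su X -> L X.
Proof.
suff [i [j bij]] : exists i j, bicoloured L i j.
  exact: (su_of_one_bicoloured lieL coloured_all bij).
case: loop_or_odd => [[x [c]]|[x0 [c0 [s [_ + sx0 so]]]]].
  (* Blue and Red edges have distinct endpoints, so a self-loop is Green. *)
  move=> e; move: (coloured_union e); case: c e => e; try by case; rewrite eqxx.
  by move=> _; apply: (@green_union_bicoloured x); move: e => /= /andP[].
by move=> /odd_walk_bicoloured /=; rewrite sx0 eqxx so => -[].
Qed.
End GraphCriterion.

(** * The real Frobenius inner product, SU(n) and su(n) *)

Section Frobenius.
Context {R : realType}.
Local Notation C := (complex R).
Local Notation Re := (@complex.Re R).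
Local Notation Im := (@complex.Im R).

Lemma ReD (x y : C) : Re (x + y) = Re x + Re y.
Proof. by case: x; case: y. Qed.
Lemma ImD (x y : C) : Im (x + y) = Im x + Im y.
Proof. by case: x; case: y. Qed.
Lemma ReN (x : C) : Re (- x) = - Re x. Proof. by case: x. Qed.
Lemma ImN (x : C) : Im (- x) = - Im x. Proof. by case: x. Qed.
Lemma ReM (x y : C) : Re (x * y) = Re x * Re y - Im x * Im y.
Proof. by case: x; case: y. Qed.
Lemma ImM (x y : C) : Im (x * y) = Re x * Im y + Im x * Re y.
Proof. by case: x; case: y. Qed.
Lemma ReJ (x : C) : Re (x^*)%C = Re x. Proof. by case: x. Qed.
Lemma ImJ (x : C) : Im (x^*)%C = - Im x. Proof. by case: x. Qed.

Lemma Re_sum (I : Type) (r : seq I) (P : pred I) (F : I -> C) :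
  Re (\sum_(i <- r | P i) F i) = \sum_(i <- r | P i) Re (F i).
Proof. exact: (big_morph Re ReD). Qed.
Lemma Im_sum (I : Type) (r : seq I) (P : pred I) (F : I -> C) :
  Im (\sum_(i <- r | P i) F i) = \sum_(i <- r | P i) Im (F i).
Proof. exact: (big_morph Im ImD). Qed.

Lemma complex_ext (x y : C) : Re x = Re y -> Im x = Im y -> x = y.
Proof. by case: x => a b; case: y => c d /= -> ->. Qed.

Context {n : nat}.
Local Notation M := 'M[C]_n.
Implicit Types X Y Z U : M.

Lemma adjmxE X i j : adjmx X i j = ((X j i)^*)%C.
Proof. by rewrite !mxE. Qed.

Lemma adjmxK X : adjmx (adjmx X) = X.
Proof. by apply/matrixP => i j; rewrite !adjmxE conjcK. Qed.

Lemma adjmxM X Y : adjmx (X *m Y) = adjmx Y *m adjmx X.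
Proof. by rewrite /adjmx map_mxM trmx_mul. Qed.

Lemma adjmxD X Y : adjmx (X + Y) = adjmx X + adjmx Y.
Proof. by apply/matrixP => i j; rewrite !(mxE, conjcD). Qed.

Lemma adjmxN X : adjmx (- X) = - adjmx X.
Proof. by apply/matrixP => i j; rewrite !(mxE, conjcN). Qed.

Lemma adjmxZ a X : adjmx (a *: X) = (a^*)%C *: adjmx X.
Proof. by apply/matrixP => i j; rewrite !(mxE, conjcM). Qed.

Lemma adjmx_rC (r : R) X : adjmx (rC r *: X) = rC r *: adjmx X.
Proof. by rewrite adjmxZ conjc_real. Qed.

Lemma adjmx0 : adjmx (0 : M) = 0.
Proof. by apply/matrixP => i j; rewrite !mxE conjc0. Qed.

Lemma adjmx1 : adjmx (1%:M : M) = 1%:M.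
Proof. by rewrite /adjmx map_mx1 trmx1. Qed.

Lemma det_adjmx X : \det (adjmx X) = ((\det X)^*)%C.
Proof. by rewrite /adjmx det_tr det_map_mx. Qed.

(* [fn] is the squared Frobenius norm. *)
Definition ip X Y : R := Re (\tr (adjmx X *m Y)).
Definition fn X : R := ip X X.

Lemma ipE X Y :
  ip X Y = \sum_i \sum_j (Re (X i j) * Re (Y i j) + Im (X i j) * Im (Y i j)).
Proof.
rewrite /ip /mxtrace Re_sum exchange_big /=; apply: eq_bigr => i _.
rewrite !mxE Re_sum; apply: eq_bigr => j _.
by rewrite adjmxE ReM ReJ ImJ mulNr opprK.
Qed.

Lemma ipC X Y : ip X Y = ip Y X.
Proof.
rewrite !ipE; apply: eq_bigr => i _; apply: eq_bigr => j _.
by rewrite mulrC [Im _ * _]mulrC.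
Qed.

Lemma ipDr X Y Z : ip X (Y + Z) = ip X Y + ip X Z.
Proof. by rewrite /ip mulmxDr raddfD /= ReD. Qed.

Lemma ipNr X Y : ip X (- Y) = - ip X Y.
Proof. by rewrite /ip mulmxN raddfN /= ReN. Qed.

Lemma ipZr X Y (r : R) : ip X (rC r *: Y) = r * ip X Y.
Proof. by rewrite /ip -scalemxAr linearZ /= ReM /= mul0r subr0. Qed.

Lemma ip0r X : ip X 0 = 0.
Proof. by rewrite /ip mulmx0 raddf0. Qed.

Lemma ipDl X Y Z : ip (Y + Z) X = ip Y X + ip Z X.
Proof. by rewrite ![ip _ X]ipC ipDr. Qed.

Lemma ipNl X Y : ip (- Y) X = - ip Y X.
Proof. by rewrite ![ip _ X]ipC ipNr. Qed.

Lemma ipZl X Y (r : R) : ip (rC r *: Y) X = r * ip Y X.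
Proof. by rewrite ![ip _ X]ipC ipZr. Qed.

Lemma ip_sumr (I : Type) (r : seq I) (P : pred I) (F : I -> M) X :
  ip X (\sum_(i <- r | P i) F i) = \sum_(i <- r | P i) ip X (F i).
Proof. exact: (big_morph (ip X) (ipDr X) (ip0r X)). Qed.

Lemma ip_suml (I : Type) (r : seq I) (P : pred I) (F : I -> M) X :
  ip (\sum_(i <- r | P i) F i) X = \sum_(i <- r | P i) ip (F i) X.
Proof. by rewrite ipC ip_sumr; apply: eq_bigr => i _; rewrite ipC. Qed.

Lemma ip_mull U X Y : ip (U *m X) Y = ip X (adjmx U *m Y).
Proof. by rewrite /ip adjmxM mulmxA. Qed.

Lemma ip_mulr U X Y : ip (X *m U) Y = ip X (Y *m adjmx U).
Proof. by rewrite /ip adjmxM -mulmxA mxtrace_mulC mulmxA. Qed.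

Lemma fnE X : fn X = \sum_i \sum_j (Re (X i j) ^+ 2 + Im (X i j) ^+ 2).
Proof. by rewrite /fn ipE. Qed.

Lemma fn_entry X i j : Re (X i j) ^+ 2 + Im (X i j) ^+ 2 <= fn X.
Proof.
rewrite fnE (bigD1 i) //= (bigD1 j) //= -addrA lerDl addr_ge0 //.
  by apply: sumr_ge0 => k _; rewrite addr_ge0 ?sqr_ge0.
by apply: sumr_ge0 => k _; apply: sumr_ge0 => l _; rewrite addr_ge0 ?sqr_ge0.
Qed.

Lemma fn_ge0 X : 0 <= fn X.
Proof.
rewrite fnE.
by apply: sumr_ge0 => k _; apply: sumr_ge0 => l _; rewrite addr_ge0 ?sqr_ge0.
Qed.

Lemma fn_eq0 X : fn X = 0 -> X = 0.
Proof.
move=> X0; apply/matrixP => i j; have := fn_entry X i j; rewrite X0 mxE => h.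
have := sqr_ge0 (Re (X i j)); have := sqr_ge0 (Im (X i j)) => h1 h2.
apply: complex_ext; apply/eqP; rewrite -sqrf_eq0; apply/eqP => /=; lra.
Qed.

Lemma fnN X : fn (- X) = fn X.
Proof. by rewrite /fn ipNl ipNr opprK. Qed.

Lemma fnB X Y : fn (X - Y) = fn X - 2 * ip X Y + fn Y.
Proof. rewrite /fn !(ipDl, ipDr, ipNl, ipNr) [ip Y X]ipC; lra. Qed.

Lemma fnD_le X Y : fn (X + Y) <= 2 * fn X + 2 * fn Y.
Proof.
have := fn_ge0 (X - Y); rewrite fnB.
rewrite /fn !(ipDl, ipDr) [ip Y X]ipC; lra.
Qed.

Lemma unitary_adjl U : U *m adjmx U = 1%:M -> adjmx U *m U = 1%:M.
Proof. exact: mulmx1C. Qed.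

Lemma fn_unitaryl U X : U *m adjmx U = 1%:M -> fn (U *m X) = fn X.
Proof. by move=> /unitary_adjl UU; rewrite /fn ip_mull mulmxA UU mul1mx. Qed.

Lemma fn_unitaryr U X : U *m adjmx U = 1%:M -> fn (X *m U) = fn X.
Proof. by move=> UU; rewrite /fn ip_mulr -mulmxA UU mulmx1. Qed.

Lemma in_SU1 : in_SU (1%:M : M).
Proof. by split; rewrite ?adjmx1 ?mulmx1 ?det1. Qed.

Lemma in_SUM X Y : in_SU X -> in_SU Y -> in_SU (X *m Y).
Proof.
move=> [XX dX] [YY dY]; split; last by rewrite det_mulmx dX dY mulr1.
by rewrite adjmxM mulmxA -(mulmxA X) YY mulmx1.
Qed.

Lemma in_SU_adj X : in_SU X -> in_SU (adjmx X).
Proof.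
move=> [XX dX]; split; last by rewrite det_adjmx dX conjc1.
by rewrite adjmxK; exact: unitary_adjl.
Qed.

Lemma in_SU_expr X k : in_SU X -> in_SU (iter k (mulmx X) 1%:M).
Proof. by move=> sX; elim: k => [|k IH] /=; [exact: in_SU1|exact: in_SUM]. Qed.

Lemma in_su_conj U X : in_SU U -> in_su X -> in_su (adjmx U *m X *m U).
Proof.
move=> [UU _] [Xsk trX]; split.
  by rewrite !adjmxM adjmxK Xsk mulmxA mulmxN mulNmx.
by rewrite mxtrace_mulC mulmxA UU mul1mx.
Qed.

Lemma in_suD X Y : in_su X -> in_su Y -> in_su (X + Y).
Proof.
move=> [Xs Xt] [Ys Yt]; split; first by rewrite adjmxD Xs Ys opprD.
by rewrite raddfD /= Xt Yt addr0.
Qed.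

Lemma in_suZ (r : R) X : in_su X -> in_su (rC r *: X).
Proof.
move=> [Xs Xt]; split; first by rewrite adjmx_rC Xs scalerN.
by rewrite linearZ /= Xt mulr0.
Qed.

Lemma in_su0 : in_su (0 : M).
Proof. by split; rewrite ?adjmx0 ?oppr0 ?raddf0. Qed.

Lemma in_su_sum (I : Type) (r : seq I) (P : pred I) (F : I -> M) :
  (forall x, P x -> in_su (F x)) -> in_su (\sum_(x <- r | P x) F x).
Proof. by move=> FP; apply: big_ind => //; [exact: in_su0|exact: in_suD]. Qed.

Lemma in_SU_fn X : in_SU X -> fn X = n%:R.
Proof.
move=> [/unitary_adjl XX _]; rewrite /fn /ip XX mxtrace1.
by elim: n => // k IH; rewrite !mulrS ReD IH.
Qed.
End Frobenius.

(** * Derivatives and continuity of matrix-valued functions *)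

Section MatrixCalculus.
Context {R : realType}.
Local Notation C := (complex R).
Local Notation Re := (@complex.Re R).
Local Notation Im := (@complex.Im R).
Implicit Types (f g : R -> C) (t : R).

(** Real and imaginary parts are differentiated separately, the form in which [solves_on] states the
    control system. *)
Definition cderiv f t (df : C) :=
  is_derive t (1 : R) (fun s => Re (f s)) (Re df) /\
  is_derive t (1 : R) (fun s => Im (f s)) (Im df).

Lemma cderiv_cst (c : C) t : cderiv (fun=> c) t 0.
Proof. by split; apply: is_derive_cst. Qed.

Lemma cderivD f g t df dg : cderiv f t df -> cderiv g t dg ->
  cderiv (fun s => f s + g s) t (df + dg).
Proof.
move=> [f1 f2] [g1 g2]; split.
  under eq_fun do rewrite ReD; rewrite ReD; exact: is_deriveD.
under eq_fun do rewrite ImD; rewrite ImD; exact: is_deriveD.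
Qed.

Lemma cderivJ f t df : cderiv f t df ->
  cderiv (fun s => ((f s)^*)%C) t (df^*)%C.
Proof.
move=> [f1 f2]; split.
  by under eq_fun do rewrite ReJ; rewrite ReJ.
under eq_fun do rewrite ImJ; rewrite ImJ; exact: is_deriveN.
Qed.

Lemma cderivM f g t df dg : cderiv f t df -> cderiv g t dg ->
  cderiv (fun s => f s * g s) t (df * g t + f t * dg).
Proof.
move=> [f1 f2] [g1 g2]; split.
  have h := is_deriveB (is_deriveM f1 g1) (is_deriveM f2 g2).
  under eq_fun do rewrite ReM; apply: (is_derive_eq h).
  by rewrite ReD !ReM /GRing.scale /=; ring.
have h := is_deriveD (is_deriveM f1 g2) (is_deriveM f2 g1).
under eq_fun do rewrite ImM; apply: (is_derive_eq h).
by rewrite ImD !ImM /GRing.scale /=; ring.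
Qed.

Lemma cderiv_sum m (F : 'I_m -> R -> C) t (dF : 'I_m -> C) :
  (forall k, cderiv (F k) t (dF k)) ->
  cderiv (fun s => \sum_k F k s) t (\sum_k dF k).
Proof.
elim: m F dF => [|m IH] F dF dFP.
  under eq_fun do rewrite big_ord0; rewrite big_ord0; exact: cderiv_cst.
under eq_fun do rewrite big_ord_recl; rewrite big_ord_recl.
by apply: cderivD => //; apply: IH.
Qed.

Lemma cderiv_affine f a v t df : cderiv f (a + t * v) df ->
  cderiv (fun s => f (a + s * v)) t (rC v * df).
Proof.
have daff : is_derive t (1 : R) (fun s : R => a + s * v) v.
  have h := is_deriveD (is_derive_cst a t 1)
    (is_deriveM (is_derive_id t 1) (is_derive_cst v t 1)).
  apply: (is_derive_eq h).
  by rewrite /GRing.scale /= /cst; ring.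
move=> [f1 f2]; split.
  rewrite ReM /= mul0r subr0 mulrC.
  exact: (@is_derive1_comp R (fun s => Re (f s)) (fun s => a + s * v) t _ _ f1 daff).
rewrite ImM /= mul0r addr0 mulrC.
exact: (@is_derive1_comp R (fun s => Im (f s)) (fun s => a + s * v) t _ _ f2 daff).
Qed.

Context {n : nat}.
Local Notation M := 'M[C]_n.
Implicit Types (X Y : R -> M).

Definition mderiv X t (dX : M) := forall i j, cderiv (fun s => X s i j) t (dX i j).

Lemma mderiv_cst (c : M) t : mderiv (fun=> c) t 0.
Proof. by move=> i j; rewrite mxE; exact: cderiv_cst. Qed.

Lemma mderivM X Y t dX dY : mderiv X t dX -> mderiv Y t dY ->
  mderiv (fun s => X s *m Y s) t (dX *m Y t + X t *m dY).
Proof.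
move=> hX hY i j; rewrite !mxE -big_split /=.
under eq_fun do rewrite mxE.
by apply: (@cderiv_sum _ (fun k s => X s i k * Y s k j)) => k; apply: cderivM.
Qed.

Lemma mderivMl (A : M) X t dX : mderiv X t dX ->
  mderiv (fun s => A *m X s) t (A *m dX).
Proof.
by move=> /(mderivM (mderiv_cst A t)); rewrite mul0mx add0r.
Qed.

Lemma mderivMr (A : M) X t dX : mderiv X t dX ->
  mderiv (fun s => X s *m A) t (dX *m A).
Proof.
by move=> /mderivM/(_ (mderiv_cst A t)); rewrite mulmx0 addr0.
Qed.

Lemma mderiv_adj X t dX : mderiv X t dX ->
  mderiv (fun s => adjmx (X s)) t (adjmx dX).
Proof.
move=> hX i j; rewrite adjmxE; under eq_fun do rewrite adjmxE.
exact: cderivJ.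
Qed.

Lemma mderiv_affine X a v t dX : mderiv X (a + t * v) dX ->
  mderiv (fun s => X (a + s * v)) t (rC v *: dX).
Proof. by move=> hX i j; rewrite mxE; exact: (cderiv_affine (hX i j)). Qed.

Lemma mderiv_Re_tr X t dX : mderiv X t dX ->
  is_derive t (1 : R) (fun s => Re (\tr (X s))) (Re (\tr dX)).
Proof.
by move=> hX; case: (@cderiv_sum n (fun k s => X s k k) t (fun k => dX k k)).
Qed.

Lemma ip_deriv (W : M) X t dX : mderiv X t dX ->
  is_derive t (1 : R) (fun s => ip W (X s)) (ip W dX).
Proof. by move=> /(mderivMl (adjmx W))/mderiv_Re_tr. Qed.

Lemma is_derive_continuous (h : R -> R) t dh :
  is_derive t (1 : R) h dh -> {for t, continuous h}.
Proof. by move=> [? _]; exact/differentiable_continuous/derivable1_diffP. Qed.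

Definition ccont (T : topologicalType) (f : T -> C) :=
  continuous (fun s => Re (f s)) /\ continuous (fun s => Im (f s)).

Definition mcont (T : topologicalType) (X : T -> M) :=
  forall i j, ccont (fun s => X s i j).

Section Continuity.
Variable T : topologicalType.

Lemma ccont_cst (c : C) : ccont (fun _ : T => c).
Proof. by split => x; exact: cst_continuous. Qed.

Lemma ccontD (f g : T -> C) : ccont f -> ccont g -> ccont (fun s => f s + g s).
Proof.
move=> [f1 f2] [g1 g2]; split => x.
  under eq_fun do rewrite ReD; exact: (continuousD (f1 x) (g1 x)).
under eq_fun do rewrite ImD; exact: (continuousD (f2 x) (g2 x)).
Qed.

Lemma ccontM (f g : T -> C) : ccont f -> ccont g -> ccont (fun s => f s * g s).
Proof.
move=> [f1 f2] [g1 g2]; split => x.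
  under eq_fun do rewrite ReM.
  exact: (continuousB (continuousM (f1 x) (g1 x)) (continuousM (f2 x) (g2 x))).
under eq_fun do rewrite ImM.
exact: (continuousD (continuousM (f1 x) (g2 x)) (continuousM (f2 x) (g1 x))).
Qed.

Lemma ccont_sum m (F : 'I_m -> T -> C) :
  (forall k, ccont (F k)) -> ccont (fun s => \sum_k F k s).
Proof.
elim: m F => [|m IH] F FP.
  under eq_fun do rewrite big_ord0; exact: ccont_cst.
by under eq_fun do rewrite big_ord_recl; apply: ccontD => //; apply: IH.
Qed.

Lemma ccontJ (f : T -> C) : ccont f -> ccont (fun s => ((f s)^*)%C).
Proof.
move=> [f1 f2]; split; first by under eq_fun do rewrite ReJ.
by under eq_fun do rewrite ImJ; move=> x; exact: (continuousN (f2 x)).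
Qed.

Lemma mcont_cst (c : M) : mcont (fun _ : T => c).
Proof. by move=> i j; exact: ccont_cst. Qed.

Lemma mcontM (X Y : T -> M) : mcont X -> mcont Y -> mcont (fun s => X s *m Y s).
Proof.
move=> hX hY i j; under eq_fun do rewrite mxE.
by apply: (@ccont_sum _ (fun k s => X s i k * Y s k j)) => k; apply: ccontM.
Qed.

Lemma mcontD (X Y : T -> M) : mcont X -> mcont Y -> mcont (fun s => X s + Y s).
Proof. by move=> hX hY i j; under eq_fun do rewrite mxE; exact: ccontD. Qed.

Lemma mcont_adj (X : T -> M) : mcont X -> mcont (fun s => adjmx (X s)).
Proof. by move=> hX i j; under eq_fun do rewrite adjmxE; exact: ccontJ. Qed.

Lemma ip_cont (X Y : T -> M) : mcont X -> mcont Y ->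
  continuous (fun s => ip (X s) (Y s)).
Proof.
move=> hX hY; case: (@ccont_sum n (fun k s => (adjmx (X s) *m Y s) k k)) => //.
by move=> k; exact: (mcontM (mcont_adj hX) hY).
Qed.
End Continuity.

Lemma mderiv_cont X dX : (forall t, mderiv X t (dX t)) -> mcont X.
Proof.
move=> hX i j; split => t; have [h1 h2] := hX t i j.
  exact: (is_derive_continuous h1).
exact: (is_derive_continuous h2).
Qed.

Lemma mcont_comp (T : topologicalType) (f : T -> R) X :
  continuous f -> mcont X -> mcont (fun s => X (f s)).
Proof.
move=> cf hX i j; have [h1 h2] := hX i j; split => x.
  exact: (continuous_comp (cf x) (h1 (f x))).
exact: (continuous_comp (cf x) (h2 (f x))).
Qed.
End MatrixCalculus.

(** * Spectral form of normal matrices, one-parameter groups and critical points of the trace *)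

Section Spectral.
Context {R : realType} {n : nat}.
Local Notation C := (complex R).
Local Notation M := 'M[C]_n.
Local Notation Re := (@complex.Re R).
Local Notation Im := (@complex.Im R).
Implicit Types (U X : M) (d e : 'rV[C]_n).

Definition unitary U := U *m adjmx U = 1%:M.

(** For unitary [U], a normal matrix in spectral form: products, adjoints, traces and determinants
    are computed on the eigenvalues [d]. *)
Definition udiag U d : M := adjmx U *m diag_mx d *m U.

Lemma normal_udiag X : X *m adjmx X = adjmx X *m X ->
  exists U d, unitary U /\ X = udiag U d.
Proof.
have cE (Y : M) : map_mx Num.conj Y^T = adjmx Y.
  by apply/matrixP => i j; rewrite !mxE.
move=> nX; have /orthomx_spectralP XE : X \is normalmx.
  by apply/normalmxP; rewrite cE.
have /unitarymxP := spectral_unitarymx X.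
exists (spectralmx X), (spectral_diag X); split; first by rewrite /unitary -cE.
by rewrite /udiag -cE -invmx_unitary ?spectral_unitarymx.
Qed.

Lemma udiagM U d e : unitary U ->
  udiag U d *m udiag U e = udiag U (\row_k (d 0 k * e 0 k)).
Proof.
move=> UU; rewrite /udiag !mulmxA -(mulmxA (_ *m diag_mx d)) UU mulmx1.
by rewrite -(mulmxA (adjmx U)) mulmx_diag.
Qed.

Lemma udiag_adj U d : adjmx (udiag U d) = udiag U (\row_k ((d 0 k)^*)%C).
Proof.
rewrite /udiag !adjmxM adjmxK mulmxA; congr (_ *m _ *m _).
apply/matrixP => i j; rewrite !mxE [j == i]eq_sym.
by case: eqVneq => [->|_]; rewrite ?mulr1n ?mulr0n ?conjc0.
Qed.

Lemma udiag1 U d : unitary U -> (forall k, d 0 k = 1) -> udiag U d = 1%:M.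
Proof.
move=> /mulmx1C UU d1; rewrite /udiag (_ : diag_mx d = 1%:M) ?mulmx1 //.
by apply/matrixP => i j; rewrite !mxE d1.
Qed.

Lemma udiagB U d e : udiag U d - udiag U e = udiag U (d - e).
Proof. by rewrite /udiag raddfB /= mulmxBr mulmxBl. Qed.

Lemma udiag_tr U d : unitary U -> \tr (udiag U d) = \sum_k d 0 k.
Proof. by move=> UU; rewrite /udiag mxtrace_mulC mulmxA UU mul1mx mxtrace_diag. Qed.

Lemma udiag_det U d : unitary U -> \det (udiag U d) = \prod_k d 0 k.
Proof.
move=> UU; rewrite /udiag !det_mulmx det_diag mulrAC -det_mulmx.
by rewrite (mulmx1C UU) det1 mul1r.
Qed.

Lemma udiag_inj U d e : unitary U -> udiag U d = udiag U e -> d = e.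
Proof.
move=> UU /(congr1 (fun Y => U *m Y *m adjmx U)); rewrite /udiag.
rewrite !mulmxA UU !mul1mx -!mulmxA UU !mulmx1 => /matrixP h.
by apply/rowP => k; have := h k k; rewrite !mxE eqxx !mulr1n.
Qed.

Lemma fn_udiag_ge U d k : unitary U ->
  Re (d 0 k) ^+ 2 + Im (d 0 k) ^+ 2 <= fn (udiag U d).
Proof.
move=> UU; have -> : fn (udiag U d) = fn (diag_mx d).
  rewrite /udiag fn_unitaryr // fn_unitaryl // adjmxK; exact: mulmx1C.
by have := fn_entry (diag_mx d) k k; rewrite !mxE eqxx mulr1n.
Qed.

Lemma in_su_udiag U (x : 'I_n -> R) : unitary U -> \sum_k x k = 0 ->
  in_su (udiag U (\row_k Complex 0 (x k))).
Proof.
move=> UU x0; split.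
  rewrite udiag_adj -sub0r (_ : 0 = udiag U 0); last first.
    by rewrite /udiag raddf0 mulmx0 mul0mx.
  rewrite udiagB; congr (udiag U _); apply/rowP => k; rewrite !mxE.
  by apply: complex_ext => /=; rewrite ?subr0 ?sub0r.
rewrite udiag_tr //; apply: complex_ext; rewrite ?Re_sum ?Im_sum /=.
  by rewrite big1 // => k _; rewrite mxE.
by rewrite -[RHS]x0; apply: eq_bigr => k _; rewrite mxE.
Qed.

(** The complex exponential of ['i * r]. *)
Definition cis (r : R) : C := Complex (cos r) (sin r).

Lemma cisD a b : cis (a + b) = cis a * cis b.
Proof. by apply: complex_ext; rewrite ?ReM ?ImM /= ?cosD ?sinD //; ring. Qed.

Lemma cis0 : cis 0 = 1.
Proof. by rewrite /cis cos0 sin0. Qed.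

Lemma cisJ a : ((cis a)^*)%C = cis (- a).
Proof. by rewrite /cis cosN sinN. Qed.

Lemma cis_unit a : cis a * ((cis a)^*)%C = 1.
Proof. by rewrite cisJ -cisD subrr cis0. Qed.

Lemma cis_sum (I : Type) (r : seq I) (P : pred I) (F : I -> R) :
  cis (\sum_(i <- r | P i) F i) = \prod_(i <- r | P i) cis (F i).
Proof. exact: (big_morph cis cisD cis0). Qed.

Lemma cis_surj (z : C) : z * (z^*)%C = 1 -> exists a, z = cis a.
Proof.
move=> /(congr1 Re); rewrite ReM ReJ ImJ mulrN opprK.
case: z => x y /= xy1.
have x1 : -1 <= x <= 1 by apply/andP; split; nra.
have cx : cos (acos x) = x by rewrite acosK // in_itv.
have s2 : sin (acos x) ^+ 2 = y ^+ 2.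
  have := cos2Dsin2 (acos x); rewrite cx => h; move: xy1 h; rewrite -!expr2; lra.
have /eqP := s2; rewrite eqf_sqr => /orP[] /eqP sE.
  by exists (acos x); rewrite /cis cx sE.
by exists (- acos x); rewrite /cis cosN sinN cx sE opprK.
Qed.

Lemma cis_deriv a t : cderiv (fun s => cis (s * a)) t (Complex 0 a * cis (t * a)).
Proof.
have h : cderiv cis (0 + t * a) ('i%C * cis (t * a)).
  rewrite add0r; split.
    rewrite ReM /= mul0r sub0r mul1r; exact: is_derive_cos.
  rewrite ImM /= mul0r add0r mul1r; exact: is_derive_sin.
have := cderiv_affine h; under eq_fun do rewrite add0r.
suff -> : rC a * ('i%C * cis (t * a)) = Complex 0 a * cis (t * a) by [].
by rewrite mulrA; congr (_ * _); apply: complex_ext; rewrite ?ReM ?ImM /=; ring.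
Qed.

(** [E] stands for the one-parameter group [exp (t A)], characterized by the properties needed
    later; existence is obtained by diagonalization. *)
Record is_flow (A : M) (E : R -> M) : Prop := {
  flow0 : E 0 = 1%:M;
  flow_deriv : forall t, mderiv E t (A *m E t);
  flow_comm : forall t, A *m E t = E t *m A;
  flow_SU : forall t, in_SU (E t) }.

Definition udiag_exp U (x : 'I_n -> R) t := udiag U (\row_k cis (t * x k)).

Lemma udiag_exp_flow U x : unitary U -> \sum_k x k = 0 ->
  is_flow (udiag U (\row_k Complex 0 (x k))) (udiag_exp U x).
Proof.
move=> UU x0; split.
- by apply: udiag1 => // k; rewrite mxE mul0r cis0.
- move=> t; rewrite /udiag_exp udiagM //.
  apply: mderivMr; apply: mderivMl => i j; rewrite !mxE.
  under eq_fun do rewrite !mxE.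
  case: eqVneq => _; last by under eq_fun do rewrite mulr0n; rewrite mulr0n; exact: cderiv_cst.
  by under eq_fun do rewrite mulr1n; rewrite mulr1n; exact: cis_deriv.
- move=> t; rewrite !udiagM //; congr (udiag U _); apply/rowP => k.
  by rewrite !mxE mulrC.
- move=> t; split.
    rewrite udiag_adj udiagM //; apply: udiag1 => // k.
    by rewrite !mxE cis_unit.
  rewrite udiag_det //; under eq_bigr => k _ do rewrite mxE.
  by rewrite -cis_sum -mulr_sumr x0 mulr0 cis0.
Qed.

Lemma udiag_expD U x s t : unitary U ->
  udiag_exp U x (s + t) = udiag_exp U x s *m udiag_exp U x t.
Proof.
move=> UU; rewrite udiagM //; congr (udiag U _); apply/rowP => k.
by rewrite !mxE mulrDl cisD.
Qed.

(** Skewness makes the eigenvalues imaginary, so their exponentials have modulus 1; trace zero makes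
    the determinant 1. *)
Lemma flow_exists A : in_su A -> exists E, is_flow A E.
Proof.
move=> [Ask trA]; have [U [d [UU AE]]] : exists U d, unitary U /\ A = udiag U d.
  by apply: normal_udiag; rewrite Ask mulmxN mulNmx.
have dI k : d 0 k = Complex 0 (Im (d 0 k)).
  have : (\row_k ((d 0 k)^*)%C) = 0 - d.
    apply: (udiag_inj UU); rewrite -udiagB -udiag_adj -AE Ask.
    by rewrite (_ : udiag U 0 = 0) ?sub0r // /udiag raddf0 mulmx0 mul0mx.
  move=> /rowP/(_ k); rewrite !mxE sub0r; case: (d 0 k) => a b /eqP.
  rewrite eq_complex /= => /andP[/eqP aN _]; congr Complex; lra.
have dE : d = \row_k Complex 0 (Im (d 0 k)) by apply/rowP => k; rewrite mxE -dI.
exists (udiag_exp U (fun k => Im (d 0 k))).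
have := @udiag_exp_flow U (fun k => Im (d 0 k)) UU.
rewrite -dE -AE; apply; move: trA; rewrite AE udiag_tr // => /(congr1 Im).
by rewrite Im_sum.
Qed.

Lemma SU_udiag Y : in_SU Y -> exists U d,
  [/\ unitary U, Y = udiag U d, forall k, d 0 k * ((d 0 k)^*)%C = 1
    & \prod_k d 0 k = 1].
Proof.
move=> [YY dY]; have [U [d [UU YE]]] : exists U d, unitary U /\ Y = udiag U d.
  by apply: normal_udiag; rewrite YY (mulmx1C YY).
exists U, d; split=> //; last by rewrite -(udiag_det _ UU) -YE.
move=> k; have : \row_k (d 0 k * ((d 0 k)^*)%C) = \row_k 1.
  apply: (udiag_inj UU); rewrite [RHS]udiag1 //; last by move=> k'; rewrite mxE.
  rewrite -YY YE udiag_adj udiagM //; congr (udiag U _).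
  by apply/rowP => k'; rewrite !mxE.
by move=> /rowP/(_ k); rewrite !mxE.
Qed.

(** Surjectivity of the exponential onto SU(n). Angles of the eigenvalues need not sum to zero, but
    replacing one by minus the sum of the others does not change its [cis], because the determinant
    is 1. *)
Lemma SU_angles Y : in_SU Y -> exists U x,
  [/\ unitary U, \sum_k x k = 0 & Y = udiag_exp U x 1].
Proof.
move=> /SU_udiag[U [d [UU YE d1 dprod]]].
have /choice[x xE] : forall k, exists a, d 0 k = cis a.
  by move=> k; exact/cis_surj/d1.
case: (pickP (@predT 'I_n)) => [k0 _|no]; last first.
  exists U, x; split=> //; first by rewrite big1 // => k; have := no k.
  by apply/matrixP => i; have := no i.
pose y k := if k == k0 then - \sum_(k | k != k0) x k else x k.
have yE k : k != k0 -> y k = x k by rewrite /y => /negbTE->.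
exists U, y; split=> //.
  by rewrite (bigD1 k0) //= (eq_bigr x yE) /y eqxx addNr.
rewrite YE; congr (udiag U _); apply/rowP => k; rewrite mxE mul1r.
have [->|kk0] := eqVneq k k0; last by rewrite yE.
rewrite /y eqxx -cisJ cis_sum; move: dprod; rewrite (bigD1 k0) //=.
rewrite (eq_bigr (fun k => cis (x k))) => [|j _]; last exact: xE.
rewrite -cis_sum => /(congr1 (fun z => z * ((cis (\sum_(k | k != k0) x k))^*)%C)).
by rewrite -mulrA cis_unit mulr1 mul1r.
Qed.

(** If [z] were not 1, its powers of exponent below [n] would sum to 0. Each of them is within
    [n * |z - 1|] of 1, which is less than 1, so the sum cannot vanish. *)
Lemma expr_near1_eq1 (z : C) : z ^+ n = 1 -> (0 < n)%N ->
  `|z - 1| < (n.+1%:R)^-1 -> `|z| = 1 -> z = 1.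
Proof.
move=> zn n0 zlt z1; apply/eqP; rewrite -subr_eq0; apply: contraT => zn1.
have s0 : \sum_(k < n) z ^+ k = 0.
  apply/eqP; have := subrX1 z n; rewrite zn subrr => /esym/eqP.
  by rewrite mulf_eq0 (negbTE zn1).
have bnd k : `|1 - z ^+ k| <= k%:R * `|z - 1|.
  elim: k => [|k IH]; first by rewrite expr0 subrr normr0 mul0r.
  rewrite exprS (_ : 1 - z * z ^+ k = (1 - z) + z * (1 - z ^+ k)); last by ring.
  rewrite (le_trans (ler_normD _ _)) // normrM z1 mul1r distrC.
  by rewrite -natr1 mulrDl mul1r addrC lerD2r.
have : (n%:R : C) <= \sum_(k < n) `|1 - z ^+ k|.
  rewrite -[X in X <= _]normr_nat (_ : n%:R = \sum_(k < n) (1 - z ^+ k)).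
    exact: ler_norm_sum.
  by rewrite sumrB s0 subr0 sumr_const card_ord.
have : \sum_(k < n) `|1 - z ^+ k| <= \sum_(k < n) n%:R * `|z - 1|.
  apply: ler_sum => k _; apply: le_trans (bnd k) _.
  by rewrite ler_wpM2r // ler_nat ltnW.
rewrite sumr_const card_ord -[(n%:R * _) *+ n]mulr_natl => h1 h2.
have := le_trans h2 h1; rewrite -[X in X <= _]mulr1 ler_pM2l ?ltr0n // => h3.
suff : n%:R * `|z - 1| < 1 by move=> /(le_lt_trans h3); rewrite ltxx.
apply: (@lt_le_trans _ _ (n%:R * n.+1%:R^-1)); first by rewrite ltr_pM2l ?ltr0n.
by rewrite ler_pdivrMr ?ltr0n // mul1r ler_nat.
Qed.

(* A critical point of [Re \tr] on SU(n) has eigenvalues with equal imaginary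
   parts; near the identity they are then all equal to one n-th root of 1. *)
Lemma SU_critical_near1 (Z : M) : in_SU Z ->
  (forall K, in_su K -> Re (\tr (K *m Z)) = 0) ->
  fn (Z - 1%:M) < ((n.+1%:R)^-1) ^+ 2 -> Z = 1%:M.
Proof.
move=> /SU_udiag[U [d [UU ZE d1 dprod]]] crit near1.
case: (pickP (@predT 'I_n)) => [k0 _|no]; last by apply/matrixP => i; have := no i.
have n0 : (0 < n)%N by rewrite -[n]card_ord; apply/card_gt0P; exists k0.
have Ieq k : Im (d 0 k) = Im (d 0 k0).
  have [->//|kk0] := eqVneq k k0.
  (* The test direction is ['i (E_kk - E_k0k0)] in the eigenbasis; criticality along it compares two
     imaginary parts. *)
  pose x j : R := (j == k)%:R - (j == k0)%:R.
  have x0 : \sum_j x j = 0.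
    rewrite sumrB (bigD1 k) //= eqxx big1 => [|j /negbTE->//].
    by rewrite (bigD1 k0) //= eqxx big1 => [|j /negbTE->//]; rewrite subrr.
  have := crit _ (in_su_udiag UU x0); rewrite ZE udiagM // udiag_tr // Re_sum.
  rewrite (bigD1 k) //= (bigD1 k0) 1?eq_sym //= big1 => [|j /andP[jk jk0]].
    have k0k : (k0 == k) = false by rewrite eq_sym (negbTE kk0).
    by rewrite !mxE !ReM /= /x !eqxx (negbTE kk0) k0k !mulr1n !mulr0n; lra.
  by rewrite !mxE !ReM /= /x (negbTE jk) (negbTE jk0) subr0 !mul0r subr0.
have dnear k : (Re (d 0 k) - 1) ^+ 2 + Im (d 0 k) ^+ 2 < ((n.+1%:R)^-1) ^+ 2.
  apply: le_lt_trans near1; rewrite ZE.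
  have -> : 1%:M = udiag U (\row_k 1) by rewrite udiag1 // => j; rewrite mxE.
  rewrite udiagB; have := fn_udiag_ge (d - \row_k 1) k UU.
  by rewrite !mxE ReD ReN ImD ImN /= oppr0 addr0.
have inv1 : ((n.+1%:R)^-1 : R) ^+ 2 <= 1.
  by rewrite expr_le1 // ?invr_ge0 ?ler0n // invf_le1 ?ltr0n // ler1n.
have dsq k : Re (d 0 k) ^+ 2 + Im (d 0 k) ^+ 2 = 1.
  by have /(congr1 Re) := d1 k; rewrite ReM ReJ ImJ mulrN opprK -!expr2.
(* Within distance 1 of 1 the real part is positive, so the imaginary part and the unit modulus
   determine the eigenvalue. *)
have Rpos k : 0 < Re (d 0 k).
  by have h1 := lt_le_trans (dnear k) inv1; have h2 := dsq k; lra.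
have deq k : d 0 k = d 0 k0.
  apply: complex_ext; rewrite ?Ieq //; apply/eqP.
  rewrite -(@eqrXn2 _ 2) ?ltW //; apply/eqP.
  by have := dsq k; have := dsq k0; rewrite Ieq => h1 h2; lra.
have z1 : d 0 k0 = 1.
  apply: expr_near1_eq1 => //.
  - rewrite -dprod (eq_bigr (fun=> d 0 k0)) => [|k _]; last exact: deq.
    by rewrite prodr_const card_ord.
  - rewrite -(@ltr_pXn2r _ 2) ?nnegrE ?invr_ge0 ?ler0n //.
    rewrite -add_Re2_Im2 ReD ReN ImD ImN /= oppr0 addr0.
    rewrite (_ : (n.+1%:R^-1)^+2 = (((n.+1%:R)^-1) ^+ 2)%:C%C); last first.
      by rewrite rmorphXn fmorphV rmorph_nat.
    by rewrite ltcR.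
  - apply/eqP; rewrite -(@eqrXn2 _ 2) // expr1n sqr_normc d1 //.
by rewrite ZE udiag1 // => k; rewrite deq.
Qed.
End Spectral.

(** * The semigroup of constant-control flows and the span of its orbit *)

Section Semigroup.
Context {R : realType} {n m : nat}.
Local Notation C := (complex R).
Local Notation M := 'M[C]_n.
Variables (B0 : M) (Bs : 'I_m -> M).
Hypotheses (B0su : in_su B0) (Bssu : forall k, in_su (Bs k)).

Definition ctrl_mx (u : 'I_m -> R) : M := B0 + \sum_(k < m) rC (u k) *: Bs k.

Lemma ctrl_mx_su u : in_su (ctrl_mx u).
Proof. by apply: in_suD => //; apply: in_su_sum => k _; exact: in_suZ. Qed.

Inductive sgrp : M -> Prop :=
| sgrp1 : sgrp 1%:M
| sgrp_step u E t Y : is_flow (ctrl_mx u) E -> 0 < t -> sgrp Y ->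
    sgrp (E t *m Y).

Lemma sgrpM X Y : sgrp X -> sgrp Y -> sgrp (X *m Y).
Proof.
move=> sX sY; elim: sX => [|u E t X' fE t0 _ IH]; first by rewrite mul1mx.
by rewrite -mulmxA; exact: sgrp_step fE t0 IH.
Qed.

Lemma sgrp_flow u E t : is_flow (ctrl_mx u) E -> 0 < t -> sgrp (E t).
Proof. by move=> fE t0; rewrite -[E t]mulmx1; exact: sgrp_step fE t0 sgrp1. Qed.

Lemma sgrp_SU X : sgrp X -> in_SU X.
Proof.
elim=> [|u E t Y fE _ _ IH]; first exact: in_SU1.
by apply: in_SUM => //; exact: flow_SU fE t.
Qed.

(** A two-sided derivative at 0 can be computed from the right, and the flows are in the semigroup
    only for positive times. *)
Lemma right_derive_eq0 (f : R -> R) df : is_derive (0 : R) (1 : R) f df ->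
  (forall t, 0 <= t -> f t = 0) -> df = 0.
Proof.
move=> [dv <-] f0; rewrite /derive cvg_at_rightE //.
apply: lim_near_cst => //; near=> h.
have h0 : 0 < h by near: h; exact: nbhs_right_gt.
by rewrite /= f0 ?f0 ?subrr ?scaler0 // addr0 [_ *: _]mulr1 ltW.
Unshelve. all: by end_near. Qed.

Definition orbit_perp (W : M) :=
  forall g u, sgrp g -> ip W (adjmx g *m ctrl_mx u *m g) = 0.

(** The real span of the matrices [adjmx g *m ctrl_mx u *m g], written as a double orthogonal
    complement so that no basis has to be chosen. *)
Definition orbit_span (X : M) := forall W, orbit_perp W -> ip W X = 0.

Lemma orbit_perp_conj W g : orbit_perp W -> sgrp g ->
  orbit_perp (g *m W *m adjmx g).
Proof.
move=> pW sg h u sh; rewrite ip_mulr ip_mull adjmxK !mulmxA.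
have := pW (h *m g) u (sgrpM sh sg).
by rewrite adjmxM !mulmxA.
Qed.

(** Conjugating [W] by the flow of [u] keeps it orthogonal to the orbit at nonnegative times. The
    derivative at 0 of its product with [X] is, up to sign, the product of [W] with the bracket. *)
Lemma orbit_span_brk u X : orbit_span X -> orbit_span (brk (ctrl_mx u) X).
Proof.
move=> sX W pW; have [E fE] := flow_exists (ctrl_mx_su u).
pose f t := ip X (E t *m W *m adjmx (E t)).
have f0 t : 0 <= t -> f t = 0.
  rewrite /f ipC le_eqVlt => /orP[/eqP<-|t0].
    by rewrite (flow0 fE) adjmx1 mulmx1 mul1mx; exact: sX.
  by apply/sX/orbit_perp_conj => //; exact: sgrp_flow fE t0.
have df := ip_deriv X (mderivM (mderivMr W (flow_deriv fE 0))
  (mderiv_adj (flow_deriv fE 0))).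
have := right_derive_eq0 df f0.
rewrite (flow0 fE) adjmx1 !mulmx1 mul1mx (ctrl_mx_su u).1.
rewrite ipDr mulmxN ipNr ![ip X _]ipC ip_mull ip_mulr (ctrl_mx_su u).1.
rewrite mulNmx mulmxN !ipNr opprK /brk ipDr ipNr => h.
by rewrite -[RHS]oppr0 -h opprD opprK.
Qed.

(** The span is known to be stable only under brackets with the control matrices. The elements of it
    whose bracket preserves it form a Lie subalgebra by the Jacobi identity. *)
Definition orbit_lie (X : M) :=
  orbit_span X /\ forall Y, orbit_span Y -> orbit_span (brk X Y).

Lemma orbit_lie_subalgebra : lie_subalgebra orbit_lie.
Proof.
split.
- split=> [W _|Y _ W _]; first by rewrite ip0r.
  by rewrite /brk mul0mx mulmx0 subrr ip0r.
- move=> X Y [sX bX] [sY bY]; split=> [W pW|Z sZ W pW].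
    by rewrite ipDr sX // sY // addr0.
  have -> : brk (X + Y) Z = brk X Z + brk Y Z.
    by rewrite /brk mulmxDl mulmxDr opprD addrACA.
  by rewrite ipDr (bX Z sZ W pW) (bY Z sZ W pW) addr0.
- move=> r X [sX bX]; split=> [W pW|Z sZ W pW].
    by rewrite ipZr sX // mulr0.
  have -> : brk (rC r *: X) Z = rC r *: brk X Z.
    by rewrite /brk -scalemxAl -scalemxAr scalerBr.
  by rewrite ipZr (bX Z sZ W pW) mulr0.
- move=> X Y [sX bX] [sY bY]; split=> [|Z sZ W pW]; first exact: bX.
  have -> : brk (brk X Y) Z = brk X (brk Y Z) - brk Y (brk X Z).
    rewrite /brk !mulmxBl !mulmxBr !mulmxA.
    move: (X *m Y *m Z) (Y *m X *m Z) (Z *m X *m Y) => a b c.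
    move: (Z *m Y *m X) (X *m Z *m Y) (Y *m Z *m X) => d e f.
    by apply/matrixP => i j; rewrite !mxE; ring.
  by rewrite ipDr ipNr (bX _ (bY Z sZ) W pW) (bY _ (bX Z sZ) W pW) subrr.
Qed.

Lemma orbit_lie_ctrl u : orbit_lie (ctrl_mx u).
Proof.
split=> [W pW|Y sY]; last exact: orbit_span_brk.
by have := pW _ u sgrp1; rewrite adjmx1 mulmx1 mul1mx.
Qed.

(** The span contains su(n), hence [W], which is then orthogonal to itself. *)
Lemma orbit_perp_su_eq0 W :
  (forall L, lie_subalgebra L -> (forall u, L (ctrl_mx u)) ->
     forall X, in_su X -> L X) ->
  in_su W -> orbit_perp W -> W = 0.
Proof.
move=> gen suW pW; apply: fn_eq0.
by case: (gen _ orbit_lie_subalgebra orbit_lie_ctrl W suW) => + _; apply.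
Qed.
End Semigroup.

(** * Uniform radii for finitely many open conditions *)

Section UniformRadius.
Context {R : realType}.

Lemma finite_pos_lower_bound (I : finType) (P : I -> R -> Prop) :
  (forall i e e', e' <= e -> P i e -> P i e') ->
  (forall i, exists e, 0 < e /\ P i e) ->
  exists e, 0 < e /\ forall i, P i e.
Proof.
move=> mono ex.
suff [e [e0 Pe]] : exists e, 0 < e /\ forall i, i \in enum I -> P i e.
  by exists e; split=> // i; apply: Pe; rewrite mem_enum.
elim: (enum I) => [|i s [e [e0 IH]]]; first by exists 1; split.
have [e' [e'0 Pe']] := ex i; exists (Num.min e e'); split.
  by rewrite lt_min e0 e'0.
move=> j; rewrite inE => /orP[/eqP->|js].
  by apply: mono Pe'; rewrite ge_min lexx orbT.
by apply: mono (IH j js); rewrite ge_min lexx.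
Qed.

Lemma continuous_box (N : nat) (f : 'rV[R]_N -> R) (a : 'rV[R]_N) (e : R) :
  continuous f -> 0 < e -> exists r, 0 < r /\
  forall b : 'rV[R]_N, (forall i, `|b 0 i - a 0 i| <= r) -> `|f b - f a| < e.
Proof.
move=> cf e0; have := cf a => /cvgrPdist_lt/(_ e e0)/nbhs_ballP[r /= r0 H].
exists (r / 2); split; first by rewrite divr_gt0.
move=> b hb; rewrite distrC; apply: H; split=> // i j; rewrite (ord1 i).
rewrite /ball /= distrC; apply: le_lt_trans (hb j) _.
by rewrite ltr_pdivrMr // ltr_pMr // ltr1n.
Qed.

Lemma det_continuous (N : nat) : continuous (fun W : 'M[R]_N => \det W).
Proof.
rewrite /determinant; apply: continuous_big; first exact: add_continuous.
have cp (g : 'I_N -> 'I_N) : continuous (fun W : 'M[R]_N => \prod_i W i (g i)).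
  apply: continuous_big; first exact: mul_continuous.
  by move=> i _; exact: coord_continuous.
move=> s _ W; exact: (@continuousM R _ (fun=> _) _ W (@cst_continuous _ _ _ W) (cp _ W)).
Qed.

Lemma unitmx_open (N : nat) (W : 'M[R]_N) : W \in unitmx ->
  exists e, 0 < e /\ forall W' : 'M[R]_N,
    (forall j k, `|W' j k - W j k| < e) -> W' \in unitmx.
Proof.
rewrite unitmxE unitfE -normr_gt0 => W0.
have := @det_continuous N W => /cvgrPdist_lt/(_ _ W0)/nbhs_ballP[e /= e0 H].
exists e; split=> // W' hW; rewrite unitmxE unitfE.
have := H W'; have WW' : ball W e W'.
  by split=> // i j; rewrite /ball /= distrC.
by move=> /(_ WW'); apply: contraTneq => ->; rewrite subr0 ltxx.
Qed.
End UniformRadius.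

(** * A local surjectivity theorem for maps into SU(n) *)

Section LocalSurjectivity.
Context {R : realType} {n N : nat}.
Local Notation C := (complex R).
Local Notation M := 'M[C]_n.
Local Notation Re := (@complex.Re R).
(** [K i] is the [i]-th partial derivative of [F] translated to the identity by the inverse of [F].
    The last two hypotheses make the [K i a0] a basis of su(n). *)
Variables (F : 'rV[R]_N -> M) (K : 'I_N -> 'rV[R]_N -> M) (a0 : 'rV[R]_N).
Hypotheses (Fcont : mcont F) (Kcont : forall i, mcont (K i)).
Hypotheses (FSU : forall a, in_SU (F a)) (Ksu : forall i a, in_su (K i a)).
Hypothesis Fderiv : forall a v t, mderiv (fun s => F (a + s *: v)) t
  (F (a + t *: v) *m \sum_i rC (v 0 i) *: K i (a + t *: v)).
Hypothesis Kfree : forall v : 'rV[R]_N,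
  \sum_i rC (v 0 i) *: K i a0 = 0 -> v = 0.
Hypothesis Kspan : forall X, in_su X -> (forall i, ip (K i a0) X = 0) -> X = 0.

Definition gram : 'M[R]_N := \matrix_(j, k) ip (K j a0) (K k a0).

Lemma gram_unit : gram \in unitmx.
Proof.
rewrite -row_free_unit; apply: inj_row_free => v vG; apply: Kfree.
apply: fn_eq0; rewrite /fn ip_sumr big1 // => k _; rewrite ipZr ip_suml.
move/rowP: vG => /(_ k); rewrite !mxE => vG.
rewrite (_ : \sum_(i < N) _ = 0) ?mulr0 // -[RHS]vG.
by apply: eq_bigr => j _; rewrite ipZl mxE.
Qed.

Definition box (r : R) (a : 'rV[R]_N) := forall i, `|a 0 i - a0 0 i| <= r.

(** Both matrices become the Gram matrix when every point is [a0], and invertibility is an open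
    condition. Row [j] of the second has its own point [b j], since the mean value theorem gives a
    different point for each coordinate. *)
Lemma good_box (r0 : R) : 0 < r0 -> exists r, [/\ 0 < r, r <= r0,
  (forall a, box r a -> (\matrix_(j, k) ip (K j a0) (K k a)) \in unitmx) &
  (forall b : 'I_N -> 'rV[R]_N, (forall j, box r (b j)) ->
     (\matrix_(j, k) ip (F a0 *m K j a0) (F (b j) *m K k (b j))) \in unitmx)].
Proof.
move=> r00; have [e [e0 He]] := unitmx_open gram_unit.
pose g1 (p : 'I_N * 'I_N) a := ip (K p.1 a0) (K p.2 a).
pose g2 (p : 'I_N * 'I_N) a := ip (F a0 *m K p.1 a0) (F a *m K p.2 a).
have [r [r_gt0 Hr]] : exists r, 0 < r /\ forall p,
    forall a, box r a -> `|g1 p a - g1 p a0| < e /\ `|g2 p a - g2 p a0| < e.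
  apply: finite_pos_lower_bound => [p r r' rr' H a ba|p].
    by apply: H => i; exact: le_trans (ba i) rr'.
  have c1 : continuous (g1 p) by apply: ip_cont => //; exact: mcont_cst.
  have c2 : continuous (g2 p).
    by apply: ip_cont; [exact: mcont_cst|exact: mcontM].
  have [r1 [r10 H1]] := continuous_box a0 c1 e0.
  have [r2 [r20 H2]] := continuous_box a0 c2 e0.
  exists (Num.min r1 r2); split; first by rewrite lt_min r10 r20.
  move=> a ba; split; [apply: H1|apply: H2] => i; apply: le_trans (ba i) _.
    by rewrite ge_min lexx.
  by rewrite ge_min lexx orbT.
exists (Num.min r r0); split.
- by rewrite lt_min r_gt0 r00.
- by rewrite ge_min lexx orbT.
- move=> a ba; apply: He => j k; rewrite !mxE.
  have [] // := Hr (j, k) a; move=> i; apply: le_trans (ba i) _.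
  by rewrite ge_min lexx.
- move=> b bb; apply: He => j k; rewrite !mxE.
  have [|_] := Hr (j, k) (b j).
    by move=> i; apply: le_trans (bb j i) _; rewrite ge_min lexx.
  rewrite /g2 /= [X in _ - X](_ : _ = ip (K j a0) (K k a0)) //.
  by rewrite ip_mull mulmxA (unitary_adjl (FSU a0).1) mul1mx.
Qed.

Lemma box_segment r a c : box r a -> c \in `]0, 1[%R -> box r (a0 + c *: (a - a0)).
Proof.
move=> ba /[!in_itv] /= /andP[c0 c1] i; rewrite !mxE addrAC subrr add0r normrM.
apply: le_trans (ba i); rewrite ler_piMl // ger0_norm ?ltW //.
Qed.

(** Rolle's argument along the segment from [a0] to [a], once for each function
    [ip (F a0 *m K j a0) (F _)]. The vanishing derivatives say that an invertible matrix kills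
    [a - a0]. *)
Lemma locally_injective r : (forall b : 'I_N -> 'rV[R]_N, (forall j, box r (b j)) ->
     (\matrix_(j, k) ip (F a0 *m K j a0) (F (b j) *m K k (b j))) \in unitmx) ->
  forall a, box r a -> F a = F a0 -> a = a0.
Proof.
move=> Hu a ba FE; pose v := a - a0.
pose dphi j t := ip (F a0 *m K j a0)
  (F (a0 + t *: v) *m \sum_i rC (v 0 i) *: K i (a0 + t *: v)).
have /choice[c cP] : forall j, exists c : R, c \in `]0, 1[%R /\ dphi j c = 0.
  move=> j; pose phi s := ip (F a0 *m K j a0) (F (a0 + s *: v)).
  have dphiP t : is_derive t (1 : R) phi (dphi j t) by exact/ip_deriv/Fderiv.
  have [|c cin] := @MVT R phi (dphi j) 0 1 ltr01 (fun x _ => dphiP x).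
    by apply: continuous_subspaceT => x; exact: (is_derive_continuous (dphiP x)).
  have vK : a0 + v = a by rewrite addrC subrK.
  rewrite /phi scale1r scale0r addr0 vK FE subrr subr0 mulr1 => /esym.
  by exists c.
have := Hu (fun j => a0 + c j *: v) (fun j => box_segment ba (cP j).1).
rewrite -unitmx_tr -row_free_unit => /row_free_inj inj.
have /eqP : v = 0.
  apply: inj; rewrite mul0mx; apply/rowP => j; rewrite !mxE.
  rewrite -[RHS](cP j).2 /dphi mulmx_sumr ip_sumr; apply: eq_bigr => k _.
  by rewrite !mxE -scalemxAr ipZr.
by rewrite subr_eq0 => /eqP.
Qed.

(** The boundary of the box is a finite union of compact faces avoiding [a0]; by injectivity the
    distance to [F a0] has a positive minimum on each. *)
Lemma face_gap (r : R) : 0 < r -> (forall a, box r a -> F a = F a0 -> a = a0) ->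
  exists e, 0 < e /\ forall a i, box r a -> `|a 0 i - a0 0 i| = r ->
    e <= fn (F a - F a0).
Proof.
move=> r0 inj.
have cf : continuous (fun a => fn (F a - F a0)).
  have h : mcont (fun a => F a - F a0) by apply: mcontD => //; exact: mcont_cst.
  exact: ip_cont.
pose side (s : bool) : R := if s then r else - r.
pose face (p : 'I_N * bool) : set 'rV[R]_N := [set a | forall i,
  (if i == p.1 then [set a0 0 i + side p.2]
   else `[a0 0 i - r, a0 0 i + r]) (a ord0 i)]%classic.
have facecpt p : compact (face p).
  apply: (@rV_compact R N (fun i => if i == p.1 then [set a0 0 i + side p.2]
    else `[a0 0 i - r, a0 0 i + r])%classic) => i; case: ifP => _; first exact: compact_set1.
  exact: segment_compact.
have side_abs s : `|side s| = r by case: s; rewrite /= ?normrN gtr0_norm.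
have face_box p a : face p a -> box r a /\ a != a0.
  move=> fa; split=> [i|].
    have := fa i; case: ifP => _ /=.
      by move=> ->; rewrite addrAC subrr add0r side_abs.
    by rewrite in_itv /= -ler_distl.
  apply/eqP => aE; have := fa p.1; rewrite eqxx aE /= => /eqP.
  rewrite -subr_eq0 opprD addrA subrr sub0r oppr_eq0 -normr_eq0 side_abs.
  by rewrite gt_eqF.
have [e [e0 He]] : exists e, 0 < e /\ forall p a, face p a -> e <= fn (F a - F a0).
  apply: finite_pos_lower_bound => [p e e' ee' H a fa|p].
    exact: le_trans ee' (H a fa).
  have [fne|fe] := pselect (face p !=set0)%classic; last first.
    by exists 1; split=> // a fa; exfalso; apply: fe; exists a.
  have [c cin cmin] := compact_EVT_min fne (facecpt p)
    (continuous_subspaceT cf).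
  exists (fn (F c - F a0)); split; last by move=> a fa; apply: cmin; rewrite inE.
  rewrite inE in cin; have [bc ca] := face_box _ _ cin.
  rewrite lt_neqAle fn_ge0 andbT eq_sym; apply: contra ca => /eqP/fn_eq0/eqP.
  by rewrite subr_eq0 => /eqP/(inj _ bc) ->.
exists e; split=> // a i ba ai; apply: (He (i, 0 <= a 0 i - a0 0 i)) => k /=.
case: eqVneq => [->|_] /=; last by rewrite in_itv /= -ler_distl; exact: ba.
rewrite /side; case: ifP => [/ger0_norm|/negbT]; first by rewrite ai => ->; rewrite addrC subrK.
rewrite -ltNge => /ltr0_norm; rewrite ai => ->.
by rewrite opprK addrC subrK.
Qed.

(** The coefficients solve the mixed Gram system, so the residual is orthogonal to the basis at [a0]
    and vanishes by [Kspan]. *)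
Lemma Kspan_near a X : (\matrix_(j, k) ip (K j a0) (K k a)) \in unitmx ->
  in_su X -> exists c : 'I_N -> R, X = \sum_k rC (c k) *: K k a.
Proof.
set G := \matrix_(j, k) _ => Gu Xsu.
pose b : 'cV[R]_N := \col_j ip (K j a0) X; pose c := invmx G *m b.
exists (fun k => c k 0); apply/eqP; rewrite -subr_eq0; apply/eqP/Kspan.
  apply: in_suD => //; rewrite -scaleN1r -rCN1; apply: in_suZ.
  by apply: in_su_sum => k _; exact: in_suZ.
move=> j; rewrite ipDr ipNr ip_sumr.
have : (G *m c) j 0 = b j 0 by rewrite /c mulmxA mulmxV // mul1mx.
rewrite !mxE => <-; apply/eqP; rewrite subr_eq0; apply/eqP.
by apply: eq_bigr => k _; rewrite ipZr mxE mulrC.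
Qed.

Theorem locally_surjective (r0 : R) : 0 < r0 -> exists e, 0 < e /\
  forall Y, in_SU Y -> fn (F a0 - Y) < e -> exists a, box r0 a /\ F a = Y.
Proof.
move=> r00; have [r [r_gt0 rr0 HG HH]] := good_box r00.
have inj := locally_injective HH; have [e [e0 gap]] := face_gap r_gt0 inj.
(* By [fnD_le], squared distances to [Y] below [e / 4] for both [F a] and [F a0] give less than [e]
   between them, which keeps the minimizer off the faces. The other bound is the radius of
   [SU_critical_near1]. *)
pose e1 : R := Num.min (e / 4) (((n.+1%:R)^-1) ^+ 2).
exists e1; split.
  by rewrite lt_min divr_gt0 //= exprn_gt0 // invr_gt0 ltr0n.
move=> Y SUY Ynear.
have cf : continuous (fun a => fn (F a - Y)).
  have h : mcont (fun a => F a - Y) by apply: mcontD => //; exact: mcont_cst.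
  exact: ip_cont.
pose bx : set 'rV[R]_N :=
  [set a | forall i, `[a0 0 i - r, a0 0 i + r] (a ord0 i)]%classic.
have bxcpt : compact bx.
  apply: (@rV_compact R N (fun i => `[a0 0 i - r, a0 0 i + r]%classic)) => i.
  exact: segment_compact.
have boxP a : box r a <-> bx a.
  by split=> h i; have := h i; rewrite /= in_itv /= -ler_distl.
have ba0 : box r a0 by move=> i; rewrite subrr normr0 ltW.
have [|a ain amin] := compact_EVT_min _ bxcpt (continuous_subspaceT cf).
  by exists a0; apply/boxP.
move: ain; rewrite inE => /boxP ba.
have {}amin b : box r b -> fn (F a - Y) <= fn (F b - Y).
  by move=> /boxP bb; apply: amin; rewrite inE.
have a_near : fn (F a - Y) < e1 by exact: le_lt_trans (amin _ ba0) Ynear.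
have interior i : `|a 0 i - a0 0 i| < r.
  rewrite lt_neqAle ba andbT; apply/eqP => ai; have := gap a i ba ai.
  have := fnD_le (F a - Y) (- (F a0 - Y)); rewrite fnN opprB addrA subrK => h1 h2.
  have : e1 <= e / 4 by rewrite ge_min lexx.
  by move=> h3; lra.
have crit j : ip Y (F a *m K j a) = 0.
  pose v : 'rV[R]_N := delta_mx 0 j; pose h := r - `|a 0 j - a0 0 j|.
  have h0 : 0 < h by rewrite subr_gt0.
  pose f s := ip Y (F (a + s *: v)).
  have df t := ip_deriv Y (Fderiv a v t).
  have in0 : (0 : R) \in `](- h), h[%R by rewrite in_itv /= oppr_lt0 h0.
  (* Elements of SU(n) have equal norm, so minimizing the distance to [Y] amounts to maximizing the
     product with [Y]. *)
  have f_max t : t \in `](- h), h[%R -> f t <= f 0.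
    rewrite in_itv /= -ltr_norml => th.
    have : box r (a + t *: v).
      move=> i; rewrite !mxE; have [->|_] := eqVneq i j; last first.
        by rewrite andbF mulr0 addr0; exact: ba.
      rewrite eqxx mulr1 addrAC; apply: le_trans (ler_normD _ _) _.
      by move: th; rewrite /h ltrBrDl => /ltW.
    move=> /amin; rewrite !fnB !in_SU_fn // ![ip _ Y]ipC /f scale0r addr0; lra.
  have d0 : is_derive (0 : R) (1 : R) f 0.
    apply: (derive1_at_max (a := - h) (b := h)) in0 f_max.
      by rewrite ltW // (lt_trans _ h0) // oppr_lt0.
    by move=> t _; have [] := df t.
  have := @derive_val _ _ _ _ _ _ _ d0; rewrite (@derive_val _ _ _ _ _ _ _ (df 0)).
  rewrite scale0r addr0 (bigD1 j) //= big1 => [|i /negbTE ij].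
    by rewrite addr0 /v mxE !eqxx /rC rmorph1 scale1r.
  by rewrite /v mxE eqxx ij /rC rmorph0 scale0r.
exists a; split; first by move=> i; exact: le_trans (ba i) rr0.
have [YY _] := SUY.
have : adjmx Y *m F a = 1%:M.
  apply: SU_critical_near1.
  - by apply: in_SUM => //; exact: in_SU_adj.
  - move=> X /(Kspan_near (HG a ba))[c ->]; rewrite mxtrace_mulC -mulmxA.
    rewrite -/(ip Y _) mulmx_sumr ip_sumr big1 // => k _.
    by rewrite -scalemxAr ipZr crit mulr0.
  - have -> : adjmx Y *m F a - 1%:M = adjmx Y *m (F a - Y).
      by rewrite mulmxBr (unitary_adjl YY).
    rewrite fn_unitaryl; last by rewrite adjmxK unitary_adjl.
    by apply: lt_le_trans a_near _; rewrite ge_min lexx orbT.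
by move=> /(congr1 (mulmx Y)); rewrite mulmxA YY mul1mx mulmx1.
Qed.
End LocalSurjectivity.

(** * Recurrence of powers and small roots in SU(n) *)

Section Recurrence.
Context {R : realType} {n : nat}.
Local Notation C := (complex R).
Local Notation M := 'M[C]_n.
Local Notation Re := (@complex.Re R).
Local Notation Im := (@complex.Im R).

Definition mpow (X : M) k : M := iter k (mulmx X) 1%:M.

Lemma mpowD X j k : mpow X (j + k) = mpow X j *m mpow X k.
Proof.
elim: j => [|j IH]; first by rewrite mul1mx.
by rewrite addSn /mpow /= -!/(mpow X _) IH mulmxA.
Qed.

Lemma exists_inv_lt (e : R) : 0 < e -> exists q, (q.+1%:R)^-1 < e.
Proof.
move=> e0; exists (Num.bound e^-1); rewrite invf_plt ?posrE ?ltr0n //.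
apply: lt_trans (archi_boundP _) _; first by rewrite invr_ge0 ltW.
by rewrite ltr_nat.
Qed.

(** Pigeonhole: the entries of all powers are bounded, so cutting their real and imaginary parts
    into cells of width [1/q] leaves finitely many classes. Two powers in one class are close, and
    their quotient is a positive power close to 1. *)
Lemma pow_recurrent (X : M) (e : R) : in_SU X -> 0 < e ->
  exists k, fn (mpow X k.+1 - 1%:M) < e.
Proof.
move=> sX e0.
have SUk k : in_SU (mpow X k) by exact: in_SU_expr.
(* Each of the [n * n] entries contributes two squares; adding 1 keeps [c] positive. *)
pose c : R := (n * n * 2)%:R + 1.
have c0 : 0 < c by rewrite ltr_wpDl ?ler0n.
have [q0 qe] := exists_inv_lt (divr_gt0 e0 c0); set q := q0.+1 in qe.
have q_gt0 : (0 : R) < q%:R by rewrite ltr0n.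
pose part (k : nat) (p : 'I_n * 'I_n * bool) : R :=
  if p.2 then Im (mpow X k p.1.1 p.1.2) else Re (mpow X k p.1.1 p.1.2).
have partB k p : `|part k p| <= n%:R.
  have h := fn_entry (mpow X k) p.1.1 p.1.2; rewrite in_SU_fn // in h.
  have hn : (n%:R : R) <= n%:R ^+ 2.
    by rewrite -natrX ler_nat expnS expn1; case: (n) => // n'; rewrite leq_pmulr.
  rewrite -(@ler_pXn2r _ 2) ?nnegrE ?ler0n // real_normK ?num_real //; apply: le_trans hn.
  apply: le_trans h; rewrite /part; case: p.2.
    by rewrite lerDr sqr_ge0.
  by rewrite lerDl sqr_ge0.
(* The shifted part lies between 0 and [2 n], so after scaling by [q] the cell indices run from 0 to
   [P]. *)
pose P := (n * 2 * q)%N.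
pose cell k : {ffun 'I_n * 'I_n * bool -> 'I_P.+1} :=
  [ffun p => inord (Num.trunc ((part k p + n%:R) * q%:R))].
have shift_ge0 k p : 0 <= (part k p + n%:R) * q%:R.
  rewrite mulr_ge0 ?ler0n // -lerBlDr sub0r.
  by have := partB k p; rewrite ler_norml => /andP[].
have cell_lt k p : (Num.trunc ((part k p + n%:R) * q%:R) < P.+1)%N.
  rewrite truncn_lt_nat // -natr1 ltr_pwDr // /P natrM ler_pM2r //.
  rewrite mulnC mul2n -addnn natrD lerD2r.
  by have := partB k p; rewrite ler_norml => /andP[].
have cell_close i j p : cell i = cell j -> (part i p - part j p) ^+ 2 <= q%:R^-1.
  move=> /ffunP/(_ p); rewrite !ffunE => /(congr1 (@nat_of_ord _)); rewrite !inordK // => h.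
  have /andP[l1 u1] := truncn_itv (shift_ge0 i p).
  have /andP[l2 u2] := truncn_itv (shift_ge0 j p).
  rewrite -h in l2 u2.
  have hq : `|part i p - part j p| <= q%:R^-1.
    rewrite -natr1 in u1 u2; move: l1 u1 l2 u2.
    move: (Num.trunc _)%:R => T l1 u1 l2 u2.
    rewrite ler_norml -[q%:R^-1]mul1r -mulNr ler_pdivrMr // ler_pdivlMr //.
    by apply/andP; split; lra.
  rewrite -real_normK ?num_real //; apply: (le_trans _ hq).
  rewrite expr2 ler_piMl // (le_trans hq) // invf_le1 ?ler1n //.
have close i j : cell i = cell j -> fn (mpow X i - mpow X j) < e.
  move=> cij; apply: (@le_lt_trans _ _ (\sum_(a < n) \sum_(b < n) 2 * q%:R^-1)).
    rewrite fnE; apply: ler_sum => a _; apply: ler_sum => b _.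
    have := cell_close i j (a, b, false) cij; have := cell_close i j (a, b, true) cij.
    by rewrite /part /= !mxE ReD ReN ImD ImN => h1 h2; lra.
  rewrite !sumr_const !card_ord -mulrnA.
  have := qe; rewrite ltr_pdivlMr // => /(le_lt_trans _); apply.
  rewrite -[_ *+ (n * n)]mulr_natr [2 / _]mulrC -mulrA ler_pM2l ?invr_gt0 //.
  rewrite /c !natrM; lra.
have /injectivePn[i [j ij cij]] :
    ~~ injectiveb (fun i : 'I_(#|{ffun 'I_n * 'I_n * bool -> 'I_P.+1}|.+1) => cell i).
  by apply/injectiveP => /leq_card; rewrite card_ord ltnn.
wlog lt_ij : i j ij cij / (i < j)%N.
  move=> H; have [/H|/H|/val_inj ijE] := ltngtP i j.
  - by apply.
  - by apply; rewrite 1?eq_sym.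
  - by rewrite ijE eqxx in ij.
exists (j - i).-1; rewrite prednK ?subn_gt0 //.
rewrite -(fn_unitaryl _ (SUk i).1) mulmxBr mulmx1 -mpowD subnKC ?(ltnW lt_ij) //.
exact/close/esym.
Qed.

(** [Y] is the value at time 1 of a one-parameter group, whose value at a small time [1/(q+1)] is
    the root. *)
Lemma small_root (Y : M) (e : R) : in_SU Y -> 0 < e ->
  exists y k, [/\ in_SU y, fn (1%:M - y) < e & mpow y k = Y].
Proof.
move=> /SU_angles[U [x [UU x0 ->]]] e0; have fE := udiag_exp_flow UU x0.
pose f t := fn (1%:M - udiag_exp U x t).
have Ec : mcont (udiag_exp U x) by apply: mderiv_cont (flow_deriv fE).
have cf : continuous f.
  have h : mcont (fun t => 1%:M - udiag_exp U x t).
    apply: mcontD; first exact: mcont_cst.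
    move=> i j; have [h1 h2] := Ec i j; split=> t.
      under eq_fun do rewrite mxE ReN; exact: (continuousN (h1 t)).
    under eq_fun do rewrite mxE ImN; exact: (continuousN (h2 t)).
  exact: ip_cont.
have f0 : f 0 = 0 by rewrite /f (flow0 fE) subrr /fn ip0r.
have := cf 0 => /cvgrPdist_lt/(_ e e0)/nbhs_ballP[d /= d0 H].
have [q qd] := exists_inv_lt d0.
exists (udiag_exp U x (q.+1%:R^-1)), q.+1; split.
- exact: flow_SU fE _.
- have := H (q.+1%:R^-1); rewrite f0 sub0r normrN /f ger0_norm ?fn_ge0 //; apply.
  by rewrite /ball /= sub0r normrN ger0_norm // invr_ge0 ler0n.
- have powE k t : mpow (udiag_exp U x t) k = udiag_exp U x (k%:R * t).
    elim: k => [|k IH]; first by rewrite mul0r (flow0 fE).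
    by rewrite /mpow /= -/(mpow _ _) IH -udiag_expD // -natr1 mulrDl mul1r addrC.
  by rewrite powE mulfV // pnatr_eq0.
Qed.
End Recurrence.

(** * Products of flows as functions of their times, and fullness of the semigroup *)

Section Words.
Context {R : realType} {n m : nat}.
Local Notation C := (complex R).
Local Notation M := 'M[C]_n.
Variables (B0 : M) (Bs : 'I_m -> M).
Hypotheses (B0su : in_su B0) (Bssu : forall k, in_su (Bs k)).
Hypothesis gen : forall L, lie_subalgebra L -> (forall u, L (ctrl_mx B0 Bs u)) ->
  forall X, in_su X -> L X.
Local Notation sgrp := (sgrp B0 Bs).
Local Notation letter := (M * M * (R -> M))%type.

(** A letter [(g, A, E)] applies a fixed semigroup element [g] and then the flow [E] of a constant
    control matrix [A], whose time is a free variable. *)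
Fixpoint word_ok (w : seq letter) : Prop :=
  if w is (g, A, E) :: w' then
    [/\ sgrp g, (exists u, A = ctrl_mx B0 Bs u), is_flow A E & word_ok w']
  else True.

(** Times are sequences indexed by [nat], so the tail of a word takes the shifted sequence without
    casts between dimensions. *)
Definition shift_times (t : nat -> R) : nat -> R := fun k => t k.+1.

Fixpoint wmap (w : seq letter) (t : nat -> R) : M :=
  if w is (g, A, E) :: w' then E (t 0%N) *m (g *m wmap w' (shift_times t)) else 1%:M.

(* The derivative of [wmap w] in the [j]-th time is [wmap w t *m wdir w t j]. *)
Fixpoint wdir (w : seq letter) (t : nat -> R) (j : nat) : M :=
  if w is (g, A, E) :: w' then
    if j is j'.+1 then wdir w' (shift_times t) j' else
    adjmx (g *m wmap w' (shift_times t)) *m A *m (g *m wmap w' (shift_times t))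
  else 0.

Lemma wmap_SU w t : word_ok w -> in_SU (wmap w t).
Proof.
elim: w t => [|[[g A] E] w IH] t /=; first by move=> _; exact: in_SU1.
move=> [sg _ fE wok]; apply: in_SUM; first exact: flow_SU fE _.
by apply: in_SUM; [exact: (sgrp_SU sg)|exact: IH].
Qed.

Lemma wmap_sgrp w t : word_ok w -> (forall k, 0 < t k) -> sgrp (wmap w t).
Proof.
elim: w t => [|[[g A] E] w IH] t /=; first by move=> _ _; exact: sgrp1.
move=> [sg [u AE] fE wok] t0; rewrite AE in fE.
by apply: sgrp_step fE (t0 0%N) _; apply: sgrpM => //; apply: IH => // k; exact: t0.
Qed.

Lemma wdir_su w t j : word_ok w -> in_su (wdir w t j).
Proof.
elim: w t j => [|[[g A] E] w IH] t j /=; first by move=> _; exact: in_su0.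
move=> [sg [u ->] fE wok]; case: j => [|j]; last exact: IH.
apply: in_su_conj; last exact: ctrl_mx_su.
by apply: in_SUM; [exact: (sgrp_SU sg)|exact: wmap_SU].
Qed.

Lemma wmap_deriv w (a v : nat -> R) t : word_ok w ->
  let tt := fun k => a k + t * v k in
  mderiv (fun s => wmap w (fun k => a k + s * v k)) t
    (wmap w tt *m \sum_(j < size w) rC (v j) *: wdir w tt j).
Proof.
elim: w a v => [|[[g A] E] w IH] a v /=.
  by move=> _; rewrite big_ord0 mulmx0; exact: mderiv_cst.
move=> [sg _ fE wok]; pose tt := fun k => shift_times a k + t * shift_times v k.
have dE := mderiv_affine (flow_deriv fE (a 0%N + t * v 0%N)).
have dW := mderivM dE (mderivMl g (IH (shift_times a) (shift_times v) wok)).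
rewrite big_ord_recl /= -[shift_times (fun k => a k + t * v k)]/tt.
have [PP _] : in_SU (g *m wmap w tt).
  by apply: in_SUM; [exact: (sgrp_SU sg)|exact: wmap_SU].
suff <- : rC (v 0%N) *: (A *m E (a 0%N + t * v 0%N)) *m (g *m wmap w tt) +
    E (a 0%N + t * v 0%N) *m (g *m (wmap w tt *m
      \sum_(j < size w) rC (shift_times v j) *: wdir w tt j)) =
    E (a 0%N + t * v 0%N) *m (g *m wmap w tt) *m
    (rC (v 0%N) *: (adjmx (g *m wmap w tt) *m A *m (g *m wmap w tt)) +
     \sum_(j < size w) rC (v (bump 0 j)) *: wdir w tt j) by [].
rewrite mulmxDr -scalemxAr -scalemxAl; congr (_ *: _ + _).
  (* [A] commutes with its flow, and inserting the product of [g *m wmap w tt] with its adjoint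
     produces the conjugate of [A]. *)
  rewrite (flow_comm fE) -!mulmxA; congr (_ *m _).
  by rewrite !mulmxA in PP *; rewrite PP mul1mx.
by rewrite !mulmxA.
Qed.

Lemma wmap_cont (T : topologicalType) w (t : T -> nat -> R) : word_ok w ->
  (forall k, continuous (fun x => t x k)) -> mcont (fun x => wmap w (t x)).
Proof.
elim: w t => [|[[g A] E] w IH] t /=; first by move=> _ _; exact: mcont_cst.
move=> [sg _ fE wok] ct; apply: mcontM.
  exact: (mcont_comp (ct 0%N) (mderiv_cont (flow_deriv fE))).
apply: mcontM; first exact: mcont_cst.
by apply: (IH (fun x => shift_times (t x))) => // k; exact: ct.
Qed.

Lemma wdir_cont (T : topologicalType) w (t : T -> nat -> R) j : word_ok w ->
  (forall k, continuous (fun x => t x k)) -> mcont (fun x => wdir w (t x) j).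
Proof.
elim: w t j => [|[[g A] E] w IH] t j /=; first by move=> _ _; exact: mcont_cst.
move=> [sg _ fE wok] ct; case: j => [|j]; last first.
  by apply: (IH (fun x => shift_times (t x))) => // k; exact: ct.
have cP : mcont (fun x => g *m wmap w (shift_times (t x))).
  apply: mcontM; first exact: mcont_cst.
  by apply: (wmap_cont (t := fun x => shift_times (t x))) => // k; exact: ct.
apply: (mcontM _ cP); apply: mcontM; last exact: mcont_cst.
exact: mcont_adj.
Qed.

(** Linear independence of the directions at the base point where all times are 1, which is interior
    to the positive times. *)
Definition word_free w := forall v : nat -> R,
  \sum_(j < size w) rC (v j) *: wdir w (fun=> 1) j = 0 ->
  forall j, (j < size w)%N -> v j = 0.

(** Real and imaginary parts of the entries turn the directions into independent real rows of length
    [2 n^2]. *)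
Lemma word_free_size w : word_free w -> (size w <= n * n + n * n)%N.
Proof.
move=> wf; pose W : 'M[R]_(size w, n * n + n * n) := \matrix_j
  row_mx (mxvec (map_mx (@complex.Re R) (wdir w (fun=> 1) j)))
         (mxvec (map_mx (@complex.Im R) (wdir w (fun=> 1) j))).
suff /eqP <- : row_free W by exact: rank_leq_col.
apply: inj_row_free => v vW; apply/rowP => j; rewrite mxE.
pose v' k : R := if insub k is Some i then v 0 i else 0.
have v'E (i : 'I_(size w)) : v' i = v 0 i by rewrite /v' valK.
rewrite -v'E; apply: wf => //.
under eq_bigr => i _ do rewrite v'E.
apply/matrixP => a b; rewrite summxE mxE.
have vWE k : \sum_i v 0 i * W i k = 0 by move/rowP: vW => /(_ k); rewrite !mxE.
apply: complex_ext; rewrite ?Re_sum ?Im_sum /=.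
  rewrite -[RHS](vWE (lshift _ (mxvec_index a b))); apply: eq_bigr => i _.
  have -> : W i (lshift _ (mxvec_index a b)) = complex.Re (wdir w (fun=> 1) i a b).
    by rewrite mxE row_mxEl mxvecE mxE.
  by rewrite mxE ReM /= mul0r subr0.
rewrite -[RHS](vWE (rshift _ (mxvec_index a b))); apply: eq_bigr => i _.
have -> : W i (rshift _ (mxvec_index a b)) = complex.Im (wdir w (fun=> 1) i a b).
  by rewrite mxE row_mxEr mxvecE mxE.
by rewrite mxE ImM /= mul0r addr0.
Qed.

(** The conjugate of [X] by the value [P] of the word is a nonzero element of su(n), so some [g],
    [u] in the orbit pair nontrivially with it. Prepending that letter adds a direction not
    orthogonal to [X] and keeps the old ones, all orthogonal to [X]. *)
Lemma word_free_extend w X : word_ok w -> word_free w -> in_su X ->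
  (forall j, (j < size w)%N -> ip X (wdir w (fun=> 1) j) = 0) -> X != 0 ->
  exists w', [/\ word_ok w', word_free w' & size w' = (size w).+1].
Proof.
move=> wok wf Xsu Xperp X0; pose P := wmap w (fun=> 1).
have PSU : in_SU P by exact: wmap_SU.
have [g [u [sg gX]]] : exists g u, sgrp g /\
    ip (P *m X *m adjmx P) (adjmx g *m ctrl_mx B0 Bs u *m g) <> 0.
  apply: contrapT => nex; move/eqP: X0; apply.
  have : P *m X *m adjmx P = 0.
    apply: (orbit_perp_su_eq0 B0su Bssu gen).
      by rewrite -{1}[P]adjmxK; apply: in_su_conj => //; exact: in_SU_adj.
    move=> g u sg; apply: contrapT => h; apply: nex; by exists g, u.
  move=> /(congr1 (fun Y => adjmx P *m Y *m P)); rewrite mulmx0 mul0mx.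
  by rewrite !mulmxA (unitary_adjl PSU.1) mul1mx -mulmxA (unitary_adjl PSU.1) mulmx1.
have [E fE] := flow_exists (ctrl_mx_su B0su Bssu u).
exists ((g, ctrl_mx B0 Bs u, E) :: w); split=> //=; first by split=> //; exists u.
move=> v /=; rewrite big_ord_recl /= -/P => sum0.
have v0 : v 0%N = 0.
  have := congr1 (ip X) sum0; rewrite ip0r ipDr ipZr ip_sumr big1 => [|j _]; last first.
    by rewrite ipZr (Xperp j) ?mulr0.
  rewrite addr0 => /eqP; rewrite mulf_eq0 => /orP[/eqP //|/eqP h]; case: gX.
  by rewrite ip_mulr ip_mull adjmxK -[RHS]h adjmxM !mulmxA.
case=> [//|j] jlt; apply: (wf (fun k => v k.+1)) => //.
by move: sum0; rewrite v0 /rC rmorph0 scale0r add0r.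
Qed.

(** A free word of maximal length: a nonzero element of su(n) orthogonal to its directions would
    extend it. *)
Lemma spanning_word : exists w, [/\ word_ok w, word_free w &
  forall X, in_su X -> (forall j, (j < size w)%N -> ip (wdir w (fun=> 1) j) X = 0) ->
    X = 0].
Proof.
pose Q k := `[< exists w, [/\ word_ok w, word_free w & size w = k] >].
have exQ : exists k, Q k.
  by exists 0%N; apply/asboolP; exists [::]; split=> // v _ [].
have bdQ k : Q k -> (k <= n * n + n * n)%N.
  by move=> /asboolP[w [_ /word_free_size + <-]].
case: (ex_maxnP exQ bdQ) => k /asboolP[w [wok wf wk]] kmax.
exists w; split=> // X Xsu Xperp; apply: contrapT => /eqP X0.
have Xp' j : (j < size w)%N -> ip X (wdir w (fun=> 1) j) = 0.
  by rewrite ipC; exact: Xperp.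
have [w' [wok' wf' w'k]] := word_free_extend wok wf Xsu Xp' X0.
have : Q k.+1 by apply/asboolP; exists w'; rewrite w'k wk.
by move=> /kmax; rewrite ltnn.
Qed.

Lemma sgrp_interior : exists G e, [/\ sgrp G, 0 < e &
  forall Y, in_SU Y -> fn (G - Y) < e -> sgrp Y].
Proof.
have [w [wok wf wspan]] := spanning_word; pose N := size w.
(* Default 1 keeps the times beyond the word positive; default 0 serves for increments. *)
pose ext (d : R) (a : 'rV[R]_N) k : R := if insub k is Some i then a 0 i else d.
have extE d a (i : 'I_N) : ext d a i = a 0 i by rewrite /ext valK.
pose F a := wmap w (ext 1 a); pose K (i : 'I_N) a := wdir w (ext 1 a) i.
pose a0 : 'rV[R]_N := const_mx 1.
have ext0 : ext 1 a0 = fun=> 1.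
  by apply/funext => k; rewrite /ext; case: insubP => // i _ _; rewrite mxE.
have cext k : continuous (fun a => ext 1 a k).
  rewrite /ext; case: insubP => [i _ _|_]; first exact: coord_continuous.
  by move=> a; exact: cst_continuous.
have extA a v s : ext 1 (a + s *: v) = fun k => ext 1 a k + s * ext 0 v k.
  apply/funext => k; rewrite /ext; case: insubP => [i _ _|_]; first by rewrite !mxE.
  by rewrite mulr0 addr0.
(* Radius [1/2] around times equal to 1 keeps every time positive, so each point reached lies in the
   semigroup. *)
have [||||||||e [e0 He]] := @locally_surjective R n N F K a0 _ _ _ _ _ _ _ 2^-1.
- exact: wmap_cont.
- by move=> i; exact: wdir_cont.
- by move=> a; exact: wmap_SU.
- by move=> i a; exact: wdir_su.
- move=> a v t; have := @wmap_deriv w (ext 1 a) (ext 0 v) t wok.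
  rewrite /F /K extA; under [X in _ -> mderiv X _ _]eq_fun do rewrite extA.
  by under eq_bigr => i _ do rewrite extE.
- move=> v; rewrite /K ext0 => sum0; apply/rowP => i; rewrite mxE -(extE 0).
  by apply: wf => //; under eq_bigr => j _ do rewrite extE.
- move=> X Xsu Xp; apply: wspan => // j jlt.
  by have := Xp (Ordinal jlt); rewrite /K ext0.
- by rewrite invr_gt0 ltr0n.
exists (F a0), e; split=> //.
  by apply: wmap_sgrp => // k; rewrite ext0.
move=> Y SUY /(He Y SUY)[a [ba <-]]; apply: wmap_sgrp => // k.
rewrite /ext; case: insubP => // i _ _.
by have := ba i; rewrite mxE ler_norml => /andP[h _]; lra.
Qed.

(** When [G^(k+1)] is close to 1, [G^k] serves as an approximate inverse of [G]: for [y] near 1 the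
    inverse of [G^k] times [y] is near [G], hence in the semigroup, and multiplying by [G^k]
    recovers [y]. *)
Theorem sgrp_full Y : in_SU Y -> sgrp Y.
Proof.
have [G [e [sG e0 He]]] := sgrp_interior.
have SUG := sgrp_SU sG.
(* Two squared distances below [e / 4], each doubled by [fnD_le], add up to less than [e]. *)
have [k hk] := pow_recurrent SUG (divr_gt0 e0 (ltr0n R 4)).
have sGk j : sgrp (mpow G j).
  by elim: j => [|j IH]; [exact: sgrp1|exact: sgrpM].
have near1 y : in_SU y -> fn (1%:M - y) < e / 4 -> sgrp y.
  move=> SUy hy; have SUk := sgrp_SU (sGk k).
  have -> : y = mpow G k *m (adjmx (mpow G k) *m y).
    by rewrite mulmxA SUk.1 mul1mx.
  apply: sgrpM => //; apply: He.
    by apply: in_SUM => //; exact: in_SU_adj.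
  rewrite -(fn_unitaryl _ SUk.1) mulmxBr mulmxA SUk.1 mul1mx.
  rewrite (_ : mpow G k *m G = mpow G k.+1); last first.
    by rewrite -addn1 mpowD /mpow /= mulmx1.
  rewrite -[_ - y](subrKA 1%:M); apply: le_lt_trans (fnD_le _ _) _; lra.
move=> /small_root/(_ (divr_gt0 e0 (ltr0n R 4)))[y [j [SUy hy <-]]].
by elim: j => [|j IH]; [exact: sgrp1|apply: sgrpM => //; exact: near1].
Qed.
End Words.

(** * Elements of the semigroup are reached by piecewise constant controls *)

Section Reachability.
Context {R : realType} {n m : nat}.
Local Notation C := (complex R).
Local Notation M := 'M[C]_n.
Variables (B0 : M) (Bs : 'I_m -> M).

Lemma pieces_rcons (ts : seq R) x : ts != [::] ->
  pieces (rcons ts x) = rcons (pieces ts) (last 0 ts, x).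
Proof.
case: ts => // y s _; rewrite /pieces /=; elim: s y => //= z s IH y.
by rewrite IH.
Qed.

Lemma pieces_le_last (ts : seq R) p : sorted <%R ts -> p \in pieces ts ->
  p.2 <= last 0 ts.
Proof.
elim/last_ind: ts => [//|ts x IH]; case: (eqVneq ts [::]) => [->//|ts0].
rewrite last_rcons pieces_rcons // mem_rcons inE.
case: ts ts0 IH => // y s _ IH; rewrite /= rcons_path => /andP[ps lx].
move=> /orP[/eqP -> //|pin]; apply: le_trans (IH ps pin) _.
by rewrite ltW.
Qed.

Lemma reachable_id : reachable_at B0 Bs 0 1%:M.
Proof.
exists (fun _ _ => 0), (fun=> 1%:M), [:: 0]; split=> //.
by move=> i j; split; apply: continuous_subspaceT => x; exact: cst_continuous.
Qed.

Lemma paste_continuous (T t : R) (f g : R -> R) : 0 <= T -> 0 < t ->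
  {within `[0, T], continuous f}%classic -> continuous g -> f T = g T ->
  {within `[0, T + t], continuous (fun s => if s <= T then f s else g s)}%classic.
Proof.
move=> T0 t0 cf cg fg.
have -> : `[0, T + t]%classic = (`[0, T] `|` `[T, T + t])%classic.
  apply/seteqP; split=> s /=; rewrite !in_itv /=.
    by move=> /andP[s0 sT]; have [sT'|/ltW Ts] := leP s T; [left|right]; rewrite ?s0 ?Ts.
  by move=> [/andP[s0 sT]|/andP[Ts sT]]; apply/andP; split=> //; lra.
apply: withinU_continuous; [exact: itv_closed|exact: itv_closed| |].
  apply: (subspace_eq_continuous _ cf) => s; rewrite inE /= in_itv /=.
  by move=> /andP[_ sT]; rewrite /from_subspace /= sT.
apply: (subspace_eq_continuous (f := g)); last exact: continuous_subspaceT.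
move=> s; rewrite inE /= in_itv /= => /andP[Ts _].
rewrite /from_subspace /=; have [sT|//] := leP s T.
by rewrite (_ : s = T) ?fg //; apply/eqP; rewrite eq_le sT Ts.
Qed.

(** The given trajectory runs until [T] and is continued by the flow of the constant control [u];
    [T] becomes a breakpoint where the control may jump. *)
Lemma reachable_step T Y u E t : 0 <= T -> is_flow (ctrl_mx B0 Bs u) E -> 0 < t ->
  reachable_at B0 Bs T Y -> reachable_at B0 Bs (T + t) (E t *m Y).
Proof.
move=> T0 fE t0 [w [X [ts [[ts0 tsT tsn tss] wc Xc Xs [X0 XT]]]]].
(* The equation is required only inside the open pieces, so the control may take either value at
   [T]. The two formulas for the path agree there. *)
pose w' k s := if s < T then w k s else u k.
pose X' s := if s <= T then X s else E (s - T) *m Y.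
have EY s : mderiv (fun s => E (s - T) *m Y) s (ctrl_mx B0 Bs u *m (E (s - T) *m Y)).
  have h : mderiv E (- T + s * 1) (ctrl_mx B0 Bs u *m E (s - T)).
    by rewrite mulr1 addrC; exact: flow_deriv.
  have := mderivMr Y (mderiv_affine h); rewrite rC1 scale1r mulmxA.
  by under eq_fun do rewrite mulr1 addrC.
have EYc : mcont (fun s => E (s - T) *m Y) by apply: mderiv_cont EY.
have EYT : E (T - T) *m Y = X T by rewrite subrr (flow0 fE) mul1mx XT.
exists w', X', (rcons ts (T + t)); split.
- split.
  + by case: (ts) ts0 tsn.
  + by rewrite last_rcons.
  + by case: (ts).
  + move: tss tsT; case: (ts) tsn => // y s _ /= ys sT.
    by rewrite rcons_path ys sT ltrDl.
- move=> k p; rewrite pieces_rcons // tsT mem_rcons inE => /orP[/eqP->|pin].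
    exists (fun=> u k); split=> [|s /= /andP[Ts _]].
      by apply: continuous_subspaceT => x; exact: cst_continuous.
    by rewrite /w' ltNge (ltW Ts).
  have [g [gc gE]] := wc k p pin; exists g; split=> // s sp; rewrite -gE // /w'.
  have := pieces_le_last tss pin; rewrite tsT => p2T.
  by move: sp => /andP[_ /lt_le_trans->].
- move=> i j; have [c1 c2] := Xc i j; have [e1 e2] := EYc i j.
  split.
    have -> : (fun s => reX (X' s) i j) =
        fun s => if s <= T then reX (X s) i j else reX (E (s - T) *m Y) i j.
      by apply/funext => s; rewrite /X'; case: ifP.
    by apply: paste_continuous => //; rewrite EYT.
  have -> : (fun s => imX (X' s) i j) =
      fun s => if s <= T then imX (X s) i j else imX (E (s - T) *m Y) i j.
    by apply/funext => s; rewrite /X'; case: ifP.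
  by apply: paste_continuous => //; rewrite EYT.
- move=> p; rewrite pieces_rcons // tsT mem_rcons inE => /orP[/eqP->|pin] s /=.
    move=> /andP[Ts _] i j.
    have -> : B0 + \sum_(k < m) rC (w' k s) *: Bs k = ctrl_mx B0 Bs u.
      by congr (_ + _); apply: eq_bigr => k _; rewrite /w' ltNge (ltW Ts).
    (* Derivatives are local, and near a time beyond [T] the pasted path coincides with the flow. *)
    have X'E : \near s, E (s - T) *m Y = X' s.
      have : \forall x \near s, - x < - T by apply: Nlt_nbhsl; rewrite ltrN2.
      by apply: filterS => x; rewrite ltrN2 /X' leNgt => ->.
    have X's : X' s = E (s - T) *m Y by rewrite /X' leNgt Ts.
    have [d1 d2] := EY s i j; rewrite X's; split.
      by apply: (near_eq_is_derive _ d1); apply: filterS X'E => x; rewrite /reX => ->.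
    by apply: (near_eq_is_derive _ d2); apply: filterS X'E => x; rewrite /imX => ->.
  move=> /andP[ps sp] i j.
  have sT : s < T by apply: lt_le_trans sp _; rewrite -tsT; exact: pieces_le_last.
  have -> : B0 + \sum_(k < m) rC (w' k s) *: Bs k = B0 + \sum_(k < m) rC (w k s) *: Bs k.
    by congr (_ + _); apply: eq_bigr => k _; rewrite /w' sT.
  have X'E : \near s, X s = X' s.
    have : \forall x \near s, x < T by exact: lt_nbhsl.
    by apply: filterS => x Tx; rewrite /X' ltW.
  have [|d1 d2] := Xs p pin s _ i j; first by rewrite ps sp.
  have X's : X' s = X s by rewrite /X' (ltW sT).
  rewrite X's; split.
    by apply: (near_eq_is_derive _ d1); apply: filterS X'E => x; rewrite /reX => ->.
  by apply: (near_eq_is_derive _ d2); apply: filterS X'E => x; rewrite /imX => ->.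
- rewrite /X' T0 X0; split=> //.
  by rewrite leNgt ltrDl t0 /= addrAC subrr add0r.
Qed.

Lemma sgrp_reachable Y : sgrp B0 Bs Y -> exists T, 0 <= T /\ reachable_at B0 Bs T Y.
Proof.
elim=> [|u E t X fE t0 _ [T [T0 rT]]]; first by exists 0; split=> //; exact: reachable_id.
exists (T + t); split; first by rewrite addr_ge0 // ltW.
exact: reachable_step fE t0 rT.
Qed.
End Reachability.

(** * Coefficients avoiding accidental cancellation *)

Section GenericDrift.
Context {R : realType}.

(** With [l s = z ^+ s] each sum is the value at [z] of the polynomial with coefficients [f i s].
    Any [z] outside the roots of the product of the nonzero ones works, and the factor ['X] ensures
    [z != 0]. *)
Lemma generic_coefficients (I : finType) (d : nat) (f : I -> 'I_d -> R) :
  exists l : 'I_d -> R, (forall s, l s != 0) /\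
    forall i, (exists s, f i s != 0) -> \sum_s l s * f i s != 0.
Proof.
pose p i : {poly R} := rVpoly (\row_s f i s).
pose P := 'X * \prod_(i | p i != 0) p i.
have P0 : P != 0.
  by rewrite mulf_neq0 ?polyX_eq0 //; apply/prodf_neq0.
have [z zP] : exists z, ~~ root P z.
  (* The naturals below [size P] are more candidates than a nonzero polynomial of that size has
     roots. *)
  apply: contrapT => nex; pose zs := [seq (k%:R : R) | k <- iota 0 (size P)].
  have : (size zs < size P)%N.
    apply: max_poly_roots => //.
      by apply/allP => z _; apply: contrapT => /negP h; apply: nex; exists z.
    by rewrite map_inj_uniq ?iota_uniq // => a b /eqP; rewrite eqr_nat => /eqP.
  by rewrite size_map size_iota ltnn.
move: zP; rewrite rootM rootX negb_or => /andP[z0 zp].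
exists (fun s => z ^+ s); split=> [s|i [s fs]]; first by rewrite expf_neq0.
have pi0 : p i != 0.
  apply: contraNneq fs => /(congr1 (fun q : {poly R} => q`_s)).
  by rewrite coef_rVpoly_ord mxE coef0 => ->.
have : ~~ root (p i) z.
  by apply: contra zp => rt; rewrite (bigD1 i) //= rootM rt.
rewrite /root /p /rVpoly horner_poly.
congr (_ != _); apply: eq_bigr => k _; rewrite valK mxE; exact: mulrC.
Qed.

End GenericDrift.

(** * Membership of the control generators in su(n) and in their zero pattern *)

Section Generators.
Context {R : realType} {n : nat}.
Local Notation C := (complex R).
Implicit Types i j : 'I_n.

Lemma adjmx_Emx i j : adjmx (Emx R i j) = Emx R j i.
Proof.
apply/matrixP => k l; rewrite adjmxE !mxE andbC.
by case: (_ && _); rewrite ?conjc1 ?conjc0.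
Qed.

Lemma trace_Emx i j : \tr (Emx R i j) = (i == j)%:R.
Proof.
rewrite /mxtrace (bigD1 i) //= mxE eqxx big1 => [|k ki]; last first.
  by rewrite mxE (negbTE ki).
by rewrite addr0.
Qed.

Lemma sk_su (a : C) i j : i != j -> in_su (sk a i j).
Proof.
move=> ij; split.
  by rewrite /sk adjmxD adjmxN !adjmxZ !adjmx_Emx conjcK opprB addrC.
rewrite /sk raddfB /= !mxtraceZ !trace_Emx [j == i]eq_sym (negbTE ij).
by rewrite !mulr0 subrr.
Qed.

Lemma Dmx_su i j : in_su (Dmx R i j).
Proof.
split; first by rewrite /Dmx adjmxZ conjci adjmxD adjmxN !adjmx_Emx scaleNr.
by rewrite /Dmx mxtraceZ raddfB /= !trace_Emx !eqxx subrr mulr0.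
Qed.

Lemma ctrl_gens_su (S1 S2 S3 : {set 'I_n * 'I_n}) X :
  (forall p, p \in S1 -> (p.1 < p.2)%N) -> (forall p, p \in S2 -> (p.1 < p.2)%N) ->
  X \in ctrl_gens R S1 S2 S3 -> in_su X.
Proof.
have neq (p : 'I_n * 'I_n) : (p.1 < p.2)%N -> p.1 != p.2.
  by move=> lt; rewrite -val_eqE /= ltn_eqF.
move=> h1 h2; rewrite !mem_cat => /or3P[] /mapP[p]; rewrite mem_enum => pS ->.
- by rewrite Bmx_sk; exact/sk_su/neq/h1.
- by rewrite Cmx_sk; exact/sk_su/neq/h2.
- exact: Dmx_su.
Qed.

Lemma Sigma_f_nth (gs : seq 'M[C]_n) k : Sigma_f gs gs`_k.
Proof.
exists (fun i : 'I_(size gs) => if i == k :> nat then 1 else 0).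
have [kl|kl] := ltnP k (size gs).
  rewrite (bigD1 (Ordinal kl)) //= eqxx rC1 scale1r big1 ?addr0 // => i ik.
  rewrite ifN; first by rewrite /rC rmorph0 scale0r.
  by rewrite -val_eqE in ik.
rewrite nth_default // big1 // => i _; rewrite ifN ?/rC ?rmorph0 ?scale0r //.
by rewrite ltn_eqF // (leq_trans (ltn_ord i)).
Qed.
End Generators.

(** * From the graph conditions to structural controllability *)

Theorem theorem5 (R : realType) (n d : nat) (A : 'I_d -> 'M[complex R]_n)
    (S1 S2 S3 : {set 'I_n * 'I_n}) :
  (2 <= n)%N ->
  (forall s, in_su (A s)) ->
  injective A ->
  (forall p, p \in S1 -> (p.1 < p.2)%N) ->
  (forall p, p \in S2 -> (p.1 < p.2)%N) ->
  (forall p, p \in S3 -> (p.1 < p.2)%N) ->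
  ~ gconnected (G_contr S1 S2 S3) ->
  (* (i) *)
  (forall x, (3 <= #|component (G_contr S1 S2 S3) x|)%N) ->
  (* (ii) *)
  no_multi_edge (G_drift A) ->
  gconnected (gunion (G_drift A) (G_contr S1 S2 S3)) ->
  (* (iii) *)
  has_self_loop (gunion (G_drift A) (G_contr S1 S2 S3)) \/
    has_odd_red_cycle (gunion (G_drift A) (G_contr S1 S2 S3)) ->
  struct_controllable A (ctrl_gens R S1 S2 S3).
Proof.
move=> n2 Asu _ S1lt S2lt S3lt ncon comp3 nomulti ucon loop.
set gens := ctrl_gens R S1 S2 S3.
(* The real and imaginary parts of all entries are the quantities that must not cancel in the
   drift. *)
pose f (p : 'I_n * 'I_n * bool) s : R :=
  if p.2 then complex.Im (A s p.1.1 p.1.2) else complex.Re (A s p.1.1 p.1.2).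
have [l [l0 lf]] := generic_coefficients f.
pose B0 := \sum_s rC (l s) *: A s.
have B0Re i j : complex.Re (B0 i j) = \sum_s l s * complex.Re (A s i j).
  rewrite /B0 summxE Re_sum; apply: eq_bigr => s _.
  by rewrite mxE ReM /= mul0r subr0.
have B0Im i j : complex.Im (B0 i j) = \sum_s l s * complex.Im (A s i j).
  rewrite /B0 summxE Im_sum; apply: eq_bigr => s _.
  by rewrite mxE ImM /= mul0r addr0.
have B0su : in_su B0 by apply: in_su_sum => s _; exact/in_suZ/Asu.
have Ask s i j : A s j i = - ((A s i j)^*)%C.
  by have [/matrixP/(_ j i) + _] := Asu s; rewrite !mxE => ->; rewrite opprK.
have blueE i j s : i != j -> complex.Re (A s i j) != 0 -> blue (G_drift A) i j.
  move=> ij h; rewrite /= ij; apply/existsP; exists s.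
  by rewrite [A s j i]Ask ReN ReJ opprK eqxx h.
have redE i j s : i != j -> complex.Im (A s i j) != 0 -> red (G_drift A) i j.
  move=> ij h; rewrite /= ij; apply/existsP; exists s.
  by rewrite [A s j i]Ask ImN ImJ opprK eqxx h.
(* A Blue edge excludes a Red one on the same pair, so all imaginary parts vanish there and the
   drift entry is real. *)
have blueP i j : blue (G_drift A) i j ->
    i != j /\ exists r : R, r != 0 /\ B0 i j = rC r * phase false.
  move=> bij; have /= /andP[ij /existsP[s /andP[_ Rs]]] := bij.
  split=> //; exists (complex.Re (B0 i j)); split.
    by rewrite B0Re; apply: (lf (i, j, false)); exists s.
  rewrite mulr1; apply: complex_ext => //=; rewrite B0Im big1 // => k _.
  have [->|Ik] := eqVneq (complex.Im (A k i j)) 0; first by rewrite mulr0.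
  by have := nomulti i j Blue Red bij (redE i j k ij Ik).
have redP i j : red (G_drift A) i j ->
    i != j /\ exists r : R, r != 0 /\ B0 i j = rC r * phase true.
  move=> rij; have /= /andP[ij /existsP[s /andP[_ Is]]] := rij.
  split=> //; exists (complex.Im (B0 i j)); split.
    by rewrite B0Im; apply: (lf (i, j, true)); exists s.
  have R0 : complex.Re (B0 i j) = 0.
    rewrite B0Re big1 // => k _.
    have [->|Rk] := eqVneq (complex.Re (A k i j)) 0; first by rewrite mulr0.
    by have := nomulti i j Blue Red (blueE i j k ij Rk) rij.
  by apply: complex_ext; rewrite ?ReM ?ImM /= ?R0; ring.
have greenP i : green (G_drift A) i -> B0 i i != 0.
  move=> /= /existsP[s As].
  have Is : complex.Im (A s i i) != 0.
    apply: contraNneq As => I0; apply/eqP; apply: complex_ext => //=.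
    exact: skew_diag_Re (Asu s).1.
  have : complex.Im (B0 i i) != 0.
    by rewrite B0Im; apply: (lf (i, i, true)); exists s.
  by apply: contraNneq => ->.
(* One index more than there are generators guarantees [1 <= m]; the extra control matrix is the
   default 0 of [nth]. *)
exists (size gens).+1; split=> //; exists B0, (fun k => gens`_k).
have gsu k : in_su gens`_k.
  have [kl|kl] := ltnP k (size gens); last by rewrite nth_default //; exact: in_su0.
  by apply: (ctrl_gens_su S1lt S2lt); exact: mem_nth.
split; [by exists l|by move=> k; exact: Sigma_f_nth|].
move=> Y SUY; apply: sgrp_reachable; apply: sgrp_full => //.
move=> L lieL Lctrl X.
have LB0 : L B0.
  have := Lctrl (fun=> 0); rewrite /ctrl_mx big1 ?addr0 // => k _.
  by rewrite /rC rmorph0 scale0r.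
(* A single unit control gives [B0] plus one generator, and [B0] itself is the value at zero
   control. *)
have Lgen Z : Z \in gens -> L Z.
  move=> /(nthP 0)[k kl <-]; have kl' : (k < (size gens).+1)%N by rewrite ltnW.
  have := Lctrl (fun j => if j == Ordinal kl' then 1 else 0).
  rewrite /ctrl_mx (bigD1 (Ordinal kl')) //= eqxx rC1 scale1r big1 ?addr0; last first.
    by move=> j /negbTE->; rewrite /rC rmorph0 scale0r.
  by move=> h; have := lieD lieL h (lieN lieL LB0); rewrite addrAC subrr add0r.
apply: (lie_contains_su (Gd := G_drift A) (S1 := S1) (S2 := S2) (S3 := S3)
  (B0 := B0)) => //.
- move=> p pS; apply: Lgen; rewrite !mem_cat; apply/or3P; constructor 1.
  by apply/mapP; exists p; rewrite // mem_enum.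
- move=> p pS; apply: Lgen; rewrite !mem_cat; apply/or3P; constructor 2.
  by apply/mapP; exists p; rewrite // mem_enum.
- move=> p pS; apply: Lgen; rewrite !mem_cat; apply/or3P; constructor 3.
  by apply/mapP; exists p; rewrite // mem_enum.
Qed.
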